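(* Let $n\geq 1$ and let $\Bbbk$ be a field whose characteristic is not $2$. The quiver of the algebra $\Bbbk\mathrm{OD}_n$ consists of two straightline paths (directed linear graphs $\bullet\to\bullet\to\cdots\to\bullet$, disjoint from each other), one with $n-1$ vertices and one with $n$ vertices. Moreover, $\Bbbk\mathrm{OD}_n$ has a quiver presentation in which the relations say that every composition of two consecutive arrows is zero.
   Context: $[n]=\{1,\dots,n\}$, and $\mathrm{OD}_n$ is the monoid (under composition) of all functions $f:[n]\to[n]$ that are order-preserving ($x_1\le x_2\Rightarrow f(x_1)\le f(x_2)$) or order-reversing ($x_1\le x_2\Rightarrow f(x_1)\ge f(x_2)$). $\Bbbk\mathrm{OD}_n$ is its monoid algebra. A path with $0$ vertices is empty. Algebras are finite-dimensional and unital. An algebra $A$ is split basic if $A/\mathrm{Rad}\,A\simeq\Bbbk^m$ for some $m$. For a split basic algebra $A$ with complete set of primitive orthogonal idempotents $\{e_1,\dots,e_m\}$, the quiver of $A$ is the directed graph with vertices in bijection with the $e_i$ and with arrows from $e_i$ to $e_j$ in bijection with a basis of $(e_j+\mathrm{Rad}^2A)(\mathrm{Rad}A/\mathrm{Rad}^2A)(e_i+\mathrm{Rad}^2A)$; up to isomorphism this does not depend on the chosen idempotents. Let $\mathscr{L}(A)$ be the $\Bbbk$-linear category with objects $e_1,\dots,e_m$, hom-sets $\mathscr{L}(A)(e_i,e_j)=e_jAe_i$ and composition given by the product of $A$. The free $\Bbbk$-linear category on $Q$ has as morphisms the $\Bbbk$-linear combinations of paths (with common endpoints) of $Q$. A quiver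 presentation of $A$ is a pair $(Q,R)$, with $Q$ the quiver of $A$ and $R$ a relation on the free $\Bbbk$-linear category on $Q$, such that the quotient of that category by the $\Bbbk$-linear congruence generated by $R$ is isomorphic to $\mathscr{L}(A)$. If an algebra $A$ is Morita equivalent to a split basic algebra $B$, the quiver and a quiver presentation of $B$ are also called the quiver and a quiver presentation of $A$. *)

(* Defs.v *)
From HB Require Import structures.
From mathcomp Require Import all_boot all_order all_algebra all_fingroup all_field.
From mathcomp Require Import generic_quotient finmap boolp monalg.

Set Implicit Arguments.
Unset Strict Implicit.
Unset Printing Implicit Defensive.

Import GRing.Theory.
Local Open Scope ring_scope.
Local Open Scope quotient_scope.

(** * Quotients of vector spaces *)

Record linear_equiv (k : fieldType) (V : lmodType k) := LinearEquiv {
  leqv_rel :> V -> V -> Prop;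
  leqv_refl : forall x, leqv_rel x x;
  leqv_sym : forall x y, leqv_rel x y -> leqv_rel y x;
  leqv_trans : forall y x z, leqv_rel x y -> leqv_rel y z -> leqv_rel x z;
  leqv_linear : forall a x x' y y', leqv_rel x x' -> leqv_rel y y' ->
    leqv_rel (a *: x + y) (a *: x' + y') }.

Section LinearQuotient.
Variables (k : fieldType) (V : lmodType k) (r : linear_equiv V).

Definition leqv_bool : rel V := fun x y => `[< r x y >].

Lemma leqv_bool_refl : reflexive leqv_bool.
Proof. by move=> x; apply/asboolP/leqv_refl. Qed.

Lemma leqv_bool_sym : symmetric leqv_bool.
Proof. by move=> x y; apply/asboolP/asboolP; apply: leqv_sym. Qed.

Lemma leqv_bool_trans : transitive leqv_bool.
Proof.
by move=> y x z /asboolP xy /asboolP yz; apply/asboolP/(leqv_trans xy yz).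
Qed.

Canonical leqv_equiv_rel :=
  EquivRel leqv_bool leqv_bool_refl leqv_bool_sym leqv_bool_trans.
Canonical leqv_encModRel := defaultEncModRel leqv_bool.

Definition lquot := {eq_quot leqv_bool}.
HB.instance Definition _ : EqQuotient V leqv_bool lquot := EqQuotient.on lquot.
HB.instance Definition _ := Choice.on lquot.

Definition lquot_pi (x : V) : lquot := \pi_lquot x.

Lemma lquot_piP x y : lquot_pi x = lquot_pi y <-> r x y.
Proof.
split=> [/eqP|xy].
  by rewrite /lquot_pi piE => /asboolP.
by apply/eqP; rewrite /lquot_pi piE; apply/asboolP.
Qed.

Lemma repr_lquot_pi x : r (repr (lquot_pi x)) x.
Proof. by apply/lquot_piP; rewrite /lquot_pi reprK. Qed.

Definition lquot_zero := lquot_pi 0.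
Definition lquot_add (x y : lquot) := lquot_pi (repr x + repr y).
Definition lquot_opp (x : lquot) := lquot_pi (- repr x).
Definition lquot_scale (a : k) (x : lquot) := lquot_pi (a *: repr x).

Lemma lquot_addE x y : lquot_add (lquot_pi x) (lquot_pi y) = lquot_pi (x + y).
Proof.
apply/lquot_piP.
by have := leqv_linear 1 (repr_lquot_pi x) (repr_lquot_pi y); rewrite !scale1r.
Qed.

Lemma lquot_scaleE a x : lquot_scale a (lquot_pi x) = lquot_pi (a *: x).
Proof.
apply/lquot_piP.
by have := leqv_linear a (repr_lquot_pi x) (leqv_refl r 0); rewrite !addr0.
Qed.

Lemma lquot_oppE x : lquot_opp (lquot_pi x) = lquot_pi (- x).
Proof. by rewrite -scaleN1r -lquot_scaleE /lquot_opp -scaleN1r. Qed.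

Lemma lquot_ind (P : lquot -> Prop) : (forall x, P (lquot_pi x)) -> forall q, P q.
Proof. by move=> Ppi q; have := Ppi (repr q); rewrite /lquot_pi reprK. Qed.

Lemma lquot_addA : associative lquot_add.
Proof.
elim/lquot_ind=> x; elim/lquot_ind=> y; elim/lquot_ind=> z.
by rewrite !lquot_addE addrA.
Qed.

Lemma lquot_addC : commutative lquot_add.
Proof.
by elim/lquot_ind=> x; elim/lquot_ind=> y; rewrite !lquot_addE addrC.
Qed.

Lemma lquot_add0 : left_id lquot_zero lquot_add.
Proof. by elim/lquot_ind=> x; rewrite !lquot_addE add0r. Qed.

Lemma lquot_addN : left_inverse lquot_zero lquot_opp lquot_add.
Proof. by elim/lquot_ind=> x; rewrite lquot_oppE !lquot_addE addNr. Qed.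

HB.instance Definition _ :=
  GRing.isZmodule.Build lquot lquot_addA lquot_addC lquot_add0 lquot_addN.

Lemma lquot_scaleA a b x : lquot_scale a (lquot_scale b x) = lquot_scale (a * b) x.
Proof. by elim/lquot_ind: x => x; rewrite !lquot_scaleE scalerA. Qed.

Lemma lquot_scale1 : left_id 1 lquot_scale.
Proof. by elim/lquot_ind=> x; rewrite !lquot_scaleE scale1r. Qed.

Lemma lquot_scaleDr : right_distributive lquot_scale +%R.
Proof.
move=> a; elim/lquot_ind=> x; elim/lquot_ind=> y.
by rewrite [LHS](congr1 _ (lquot_addE _ _)) !lquot_scaleE scalerDr -lquot_addE.
Qed.

Lemma lquot_scaleDl x : {morph lquot_scale^~ x : a b / a + b}.
Proof.
by move=> a b; elim/lquot_ind: x => x; rewrite !lquot_scaleE scalerDl -lquot_addE.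
Qed.

HB.instance Definition _ := GRing.Zmodule_isLmodule.Build k lquot
  lquot_scaleA lquot_scale1 lquot_scaleDr lquot_scaleDl.

Lemma lquot_pi_is_linear : linear lquot_pi.
Proof.
by move=> a x y; rewrite -lquot_addE -lquot_scaleE.
Qed.

HB.instance Definition _ :=
  GRing.isLinear.Build k V lquot _ lquot_pi lquot_pi_is_linear.

End LinearQuotient.

Section QuotientSpace.
Variables (k : fieldType) (V : vectType k) (W : {vspace V}).

Definition eqmod_vs (x y : V) : Prop := x - y \in W.

Lemma eqmod_vs_refl x : eqmod_vs x x.
Proof. by rewrite /eqmod_vs subrr mem0v. Qed.

Lemma eqmod_vs_sym x y : eqmod_vs x y -> eqmod_vs y x.
Proof. by rewrite /eqmod_vs -opprB memvN. Qed.

Lemma eqmod_vs_trans y x z : eqmod_vs x y -> eqmod_vs y z -> eqmod_vs x z.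
Proof. by move=> xy yz; rewrite /eqmod_vs -(subrKA y) memvD. Qed.

Lemma eqmod_vs_linear a x x' y y' :
  eqmod_vs x x' -> eqmod_vs y y' -> eqmod_vs (a *: x + y) (a *: x' + y').
Proof.
by move=> xx' yy'; rewrite /eqmod_vs opprD addrACA -scalerBr memvD ?memvZ.
Qed.

Definition vs_equiv : linear_equiv V :=
  LinearEquiv eqmod_vs_refl eqmod_vs_sym eqmod_vs_trans eqmod_vs_linear.

Definition quotient_space : lmodType k := lquot vs_equiv.

Definition class_mod (x : V) : quotient_space := lquot_pi vs_equiv x.

End QuotientSpace.

(* [b] is a basis of the subspace of [V] with underlying set [S]. *)
Definition basis_of_set (k : fieldType) (V : lmodType k) (S : V -> Prop)
    (T : finType) (b : T -> V) : Prop :=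
  (forall t, S (b t)) /\
  (forall v, S v -> exists! c : {ffun T -> k}, v = \sum_t c t *: b t).

(** * The radical and split basic algebras *)

Section Radical.
Variables (k : fieldType) (A : falgType k).

(* [A] is a unital [k]-algebra, so each of its left ideals is a subspace. *)
Definition left_ideal (U : {vspace A}) : Prop :=
  forall a x : A, x \in U -> a * x \in U.

Definition maximal_left_ideal (U : {vspace A}) : Prop :=
  [/\ left_ideal U, U <> fullv
    & forall U' : {vspace A}, left_ideal U' -> (U <= U')%VS ->
        U' = U \/ U' = fullv].

Lemma vs_bigcap_ex (P : {vspace A} -> Prop) :
  exists J : {vspace A}, forall x, x \in J <-> (forall U, P U -> x \in U).
Proof.
suff H n : forall V : {vspace A}, (\dim V < n)%N ->
    exists J : {vspace A}, forall x,
      x \in J <-> x \in V /\ (forall U, P U -> x \in U).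
  have [J JP] := H _ fullv (ltnSn _).
  by exists J => x; rewrite JP memvf; split=> [[]|].
elim: n => [|n IHn] V; first by rewrite ltn0.
rewrite ltnS => leVn.
have [sub|/existsNP[U /not_implyP[PU /negP nVU]]] :=
  pselect (forall U, P U -> (V <= U)%VS).
  exists V => x; split=> [xV|[]//]; split=> // U PU.
  exact: subvP (sub U PU) x xV.
have ltUV : (\dim (V :&: U) < n)%N.
  apply: leq_trans leVn; rewrite (ltn_leqif (dimv_leqif_sup (capvSl V U))).
  by rewrite subv_cap subvv.
have [J JP] := IHn _ ltUV; exists J => x; rewrite JP memv_cap.
split=> [[/andP[-> _]]|[-> xP]] //; split=> //.
by rewrite xP.
Qed.

(* The Jacobson radical: the intersection of the maximal left ideals. *)
Definition Rad : {vspace A} :=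
  projT1 (cid (vs_bigcap_ex maximal_left_ideal)).

Lemma RadP (x : A) :
  x \in Rad <-> (forall U, maximal_left_ideal U -> x \in U).
Proof. exact: (projT2 (cid (vs_bigcap_ex maximal_left_ideal))). Qed.

(* [phi] is an isomorphism of algebras from [A / Rad A] to [k ^ m], the
   product of [A / Rad A] being that of representatives. *)
Definition split_basic : Prop :=
  exists (m : nat) (phi : {linear quotient_space Rad -> {ffun 'I_m -> k^o}}),
  [/\ bijective phi, phi (class_mod Rad 1) = 1
    & forall x y : A, phi (class_mod Rad (x * y)) =
        phi (class_mod Rad x) * phi (class_mod Rad y)].

Definition idempotent_elt (x : A) : Prop := x * x = x.

Definition primitive_idempotent (x : A) : Prop :=
  [/\ idempotent_elt x, x <> 0
    & forall y z : A, idempotent_elt y -> idempotent_elt z ->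
        y * z = 0 -> z * y = 0 -> x = y + z -> y = 0 \/ z = 0].

Definition complete_primitive_orthogonal (I : finType) (e : I -> A) : Prop :=
  [/\ forall i, primitive_idempotent (e i),
      forall i j, i != j -> e i * e j = 0
    & \sum_i e i = 1].

Lemma complete_idempotent (I : finType) (e : I -> A) :
  complete_primitive_orthogonal e -> forall i, idempotent_elt (e i).
Proof. by case=> prim_e _ _ i; case: (prim_e i). Qed.

End Radical.

(** * Linear categories *)

Record lincat (k : fieldType) := LinCat {
  lobj : Type;
  lhom : lobj -> lobj -> lmodType k;
  lid : forall x, lhom x x;
  lcomp : forall x y z, lhom y z -> lhom x y -> lhom x z;
  lcompA : forall w x y z (h : lhom y z) (g : lhom x y) (f : lhom w x),
    lcomp h (lcomp g f) = lcomp (lcomp h g) f;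
  lcomp1l : forall x y (f : lhom x y), lcomp (lid y) f = f;
  lcomp1r : forall x y (f : lhom x y), lcomp f (lid x) = f;
  lcomp_linl : forall x y z a (g g' : lhom y z) (f : lhom x y),
    lcomp (a *: g + g') f = a *: lcomp g f + lcomp g' f;
  lcomp_linr : forall x y z a (g : lhom y z) (f f' : lhom x y),
    lcomp g (a *: f + f') = a *: lcomp g f + lcomp g f' }.

Arguments lid {k l} x.
Arguments lcomp {k l x y z} g f.

Section LinearCategories.
Variable k : fieldType.

Definition lincat_iso (C D : lincat k) : Prop :=
  exists (F0 : lobj C -> lobj D)
         (F : forall x y, {linear lhom x y -> lhom (F0 x) (F0 y)}),
  [/\ bijective F0,
      forall x y, bijective (F x y),
      forall x, F x x (lid x) = lid (F0 x)
    & forall x y z (g : lhom y z) (f : lhom x y),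
        F x z (lcomp g f) = lcomp (F y z g) (F x y f)].

Definition hom_relation (C : lincat k) :=
  forall x y : lobj C, lhom x y -> lhom x y -> Prop.

Record lin_congruence (C : lincat k) := LinCongruence {
  cong_rel :> forall x y : lobj C, linear_equiv (lhom x y);
  cong_comp : forall x y z (g g' : lhom y z) (f f' : lhom x y),
    cong_rel y z g g' -> cong_rel x y f f' ->
    cong_rel x z (lcomp g f) (lcomp g' f') }.

Section QuotientCategory.
Variables (C : lincat k) (r : lin_congruence C).

Definition qhom (x y : lobj C) : lmodType k := lquot (r x y).
Definition qclass x y (f : lhom x y) : qhom x y := lquot_pi (r x y) f.
Definition qcomp x y z (g : qhom y z) (f : qhom x y) : qhom x z :=
  qclass (lcomp (repr g) (repr f)).

Lemma qclass_surj x y (f : qhom x y) : exists f0, f = qclass f0.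
Proof. by exists (repr f); rewrite /qclass /lquot_pi reprK. Qed.

Lemma qcompE x y z (g : lhom y z) (f : lhom x y) :
  qcomp (qclass g) (qclass f) = qclass (lcomp g f).
Proof. by apply/lquot_piP/cong_comp; apply: repr_lquot_pi. Qed.

Lemma qcompA w x y z (h : qhom y z) (g : qhom x y) (f : qhom w x) :
  qcomp h (qcomp g f) = qcomp (qcomp h g) f.
Proof.
have [h_ ->] := qclass_surj h;
  have [g_ ->] := qclass_surj g;
  have [f_ ->] := qclass_surj f.
by rewrite !qcompE lcompA.
Qed.

Lemma qcomp1l x y (f : qhom x y) : qcomp (qclass (lid y)) f = f.
Proof. by have [f_ ->] := qclass_surj f; rewrite qcompE lcomp1l. Qed.

Lemma qcomp1r x y (f : qhom x y) : qcomp f (qclass (lid x)) = f.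
Proof. by have [f_ ->] := qclass_surj f; rewrite qcompE lcomp1r. Qed.

Lemma qcomp_linl x y z a (g g' : qhom y z) (f : qhom x y) :
  qcomp (a *: g + g') f = a *: qcomp g f + qcomp g' f.
Proof.
have [g_ ->] := qclass_surj g;
  have [g'_ ->] := qclass_surj g';
  have [f_ ->] := qclass_surj f.
by rewrite -linearP !qcompE -linearP lcomp_linl.
Qed.

Lemma qcomp_linr x y z a (g : qhom y z) (f f' : qhom x y) :
  qcomp g (a *: f + f') = a *: qcomp g f + qcomp g f'.
Proof.
have [g_ ->] := qclass_surj g;
  have [f_ ->] := qclass_surj f;
  have [f'_ ->] := qclass_surj f'.
by rewrite -linearP !qcompE -linearP lcomp_linr.
Qed.

Definition quotient_cat : lincat k :=
  LinCat qcompA qcomp1l qcomp1r qcomp_linl qcomp_linr.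

End QuotientCategory.

Section GeneratedCongruence.
Variables (C : lincat k) (R : hom_relation C).

Inductive gen_rel : forall x y : lobj C, lhom x y -> lhom x y -> Prop :=
| gen_base x y (f g : lhom x y) : R f g -> gen_rel f g
| gen_refl x y (f : lhom x y) : gen_rel f f
| gen_sym x y (f g : lhom x y) : gen_rel f g -> gen_rel g f
| gen_trans x y (g f h : lhom x y) : gen_rel f g -> gen_rel g h -> gen_rel f h
| gen_linear x y a (f f' g g' : lhom x y) :
    gen_rel f f' -> gen_rel g g' -> gen_rel (a *: f + g) (a *: f' + g')
| gen_comp x y z (g g' : lhom y z) (f f' : lhom x y) :
    gen_rel g g' -> gen_rel f f' -> gen_rel (lcomp g f) (lcomp g' f').

Definition gen_equiv x y : linear_equiv (lhom x y) :=
  LinearEquiv (@gen_refl x y) (@gen_sym x y) (@gen_trans x y) (@gen_linear x y).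

Definition generated_congruence : lin_congruence C :=
  @LinCongruence C gen_equiv gen_comp.

End GeneratedCongruence.
End LinearCategories.

(* The linear category [L(A)], with [L(A)(e i, e j) = e j * A * e i]. *)
Section AlgebraCategory.
Variables (k : fieldType) (A : falgType k) (I : finType) (e : I -> A).
Hypothesis e_idem : forall i, idempotent_elt (e i).

Definition corner (i j : I) : {vspace A} :=
  limg (amulr (e i) \o amull (e j))%VF.

Lemma cornerP i j x : (exists a, x = e j * a * e i) <-> x \in corner i j.
Proof.
split=> [[a ->]|/memv_imgP[a _ ->]]; last first.
  by exists a; rewrite comp_lfunE /= !lfunE.
by apply/memv_imgP; exists a; rewrite ?memvf // comp_lfunE /= !lfunE.
Qed.

Lemma corner_id i : e i \in corner i i.
Proof. by apply/cornerP; exists (e i); rewrite !e_idem. Qed.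

Lemma corner_mul i j l (y : subvs_of (corner j l)) (x : subvs_of (corner i j)) :
  vsval y * vsval x \in corner i l.
Proof.
have [/cornerP[b ->] /cornerP[a ->]] := (subvsP y, subvsP x).
by apply/cornerP; exists (b * e j * e j * a); rewrite !mulrA.
Qed.

Definition corner_one i : subvs_of (corner i i) := Subvs (corner_id i).
Definition corner_comp i j l
    (y : subvs_of (corner j l)) (x : subvs_of (corner i j)) :
  subvs_of (corner i l) := Subvs (corner_mul y x).

Lemma corner_compA h i j l (z : subvs_of (corner j l))
    (y : subvs_of (corner i j)) (x : subvs_of (corner h i)) :
  corner_comp z (corner_comp y x) = corner_comp (corner_comp z y) x.
Proof. by apply: val_inj; rewrite /= mulrA. Qed.

Lemma corner_comp1l i j (x : subvs_of (corner i j)) :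
  corner_comp (corner_one j) x = x.
Proof.
apply: val_inj; have /cornerP[a ea] := subvsP x.
by rewrite /= ea !mulrA e_idem.
Qed.

Lemma corner_comp1r i j (x : subvs_of (corner i j)) :
  corner_comp x (corner_one i) = x.
Proof.
apply: val_inj; have /cornerP[a ea] := subvsP x.
by rewrite /= ea -!mulrA e_idem.
Qed.

Lemma corner_comp_linl i j l a (y y' : subvs_of (corner j l))
    (x : subvs_of (corner i j)) :
  corner_comp (a *: y + y') x = a *: corner_comp y x + corner_comp y' x.
Proof. by apply: val_inj; rewrite /= mulrDl scalerAl. Qed.

Lemma corner_comp_linr i j l a (y : subvs_of (corner j l))
    (x x' : subvs_of (corner i j)) :
  corner_comp y (a *: x + x') = a *: corner_comp y x + corner_comp y x'.
Proof. by apply: val_inj; rewrite /= mulrDr scalerAr. Qed.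

Definition algebra_cat : lincat k :=
  @LinCat k I (fun i j => subvs_of (corner i j)) corner_one corner_comp
    corner_compA corner_comp1l corner_comp1r corner_comp_linl corner_comp_linr.

End AlgebraCategory.

(** * Quivers and free linear categories *)

Record quiver := Quiver {
  vertex : finType;
  arrow : finType;
  source : arrow -> vertex;
  target : arrow -> vertex }.

Arguments source {q} a.
Arguments target {q} a.

Definition arrows_between (Q : quiver) (x y : vertex Q) : finType :=
  {a : arrow Q | (source a == x) && (target a == y)}.

Section Paths.
Variable Q : quiver.

(* The arrows of a path are listed in the order in which they are followed. *)
Fixpoint is_qpath (x y : vertex Q) (p : seq (arrow Q)) : bool :=
  if p is a :: p' then (source a == x) && is_qpath (target a) y p' else x == y.

Definition qpath (x y : vertex Q) : choiceType :=
  {p : seq (arrow Q) | is_qpath x y p}.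

Lemma is_qpath_cat x y z p q :
  is_qpath x y p -> is_qpath y z q -> is_qpath x z (p ++ q).
Proof.
elim: p x => [|a p IHp] x /= => [/eqP-> //|/andP[-> pP] qP].
exact: IHp pP qP.
Qed.

Definition path_nil (x : vertex Q) : qpath x x := exist _ [::] (eqxx x).

Definition path_comp x y z (q : qpath y z) (p : qpath x y) : qpath x z :=
  exist _ (val p ++ val q) (is_qpath_cat (valP p) (valP q)).

End Paths.

Section FreeLinearCategory.
Variables (k : fieldType) (Q : quiver).

Definition free_hom (x y : vertex Q) : lmodType k := {malg k[qpath x y]}.

Definition free_comp x y z (g : free_hom y z) (f : free_hom x y) :
    free_hom x z :=
  \sum_(q <- msupp g) \sum_(p <- msupp f) << g@_q * f@_p *g path_comp q p >>.

Lemma free_compEw x y z (g : free_hom y z) (f : free_hom x y)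
    (d : {fset qpath y z}) (d' : {fset qpath x y}) :
  (msupp g `<=` d)%fset -> (msupp f `<=` d')%fset ->
  free_comp g f =
    \sum_(q <- d) \sum_(p <- d') << g@_q * f@_p *g path_comp q p >>.
Proof.
move=> le_d le_d'; rewrite /free_comp (big_fset_incl _ le_d) /=.
  apply/eq_bigr=> q _; apply/big_fset_incl => // p _ /mcoeff_outdom ->.
  by rewrite mulr0 monalgU0.
move=> q _ /mcoeff_outdom gq.
by rewrite big1 => // p _; rewrite gq mul0r monalgU0.
Qed.

Lemma scale_monalgU (K : choiceType) a c (p : K) :
  a *: (<< c *g p >> : {malg k[K]}) = << a * c *g p >>.
Proof. by apply/malgP=> r; rewrite mcoeffZ !mcoeffU mulrnAr. Qed.

Lemma msupp_linear (K : choiceType) a (g g' : {malg k[K]}) :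
  (msupp (a *: g + g') `<=` msupp g `|` msupp g')%fset.
Proof.
exact: fsubset_trans (msuppD_le _ _) (fsetSU _ (msuppZ_le _ _)).
Qed.

Lemma free_comp_linl x y z a (g g' : free_hom y z) (f : free_hom x y) :
  free_comp (a *: g + g') f = a *: free_comp g f + free_comp g' f.
Proof.
rewrite (free_compEw (msupp_linear a g g') (fsubset_refl _)).
rewrite (free_compEw (fsubsetUl _ (msupp g')) (fsubset_refl (msupp f))).
rewrite (free_compEw (fsubsetUr (msupp g) _) (fsubset_refl (msupp f))).
rewrite scaler_sumr -big_split; apply/eq_bigr => q _ /=.
rewrite scaler_sumr -big_split; apply/eq_bigr => p _ /=.
rewrite mcoeffD mcoeffZ mulrDl monalgUD -mulrA; congr (_ + _)%R.
by rewrite scale_monalgU.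
Qed.

Lemma free_comp_linr x y z a (g : free_hom y z) (f f' : free_hom x y) :
  free_comp g (a *: f + f') = a *: free_comp g f + free_comp g f'.
Proof.
rewrite (free_compEw (fsubset_refl _) (msupp_linear a f f')).
rewrite (free_compEw (fsubset_refl (msupp g)) (fsubsetUl _ (msupp f'))).
rewrite (free_compEw (fsubset_refl (msupp g)) (fsubsetUr (msupp f) _)).
rewrite scaler_sumr -big_split; apply/eq_bigr => q _ /=.
rewrite scaler_sumr -big_split; apply/eq_bigr => p _ /=.
rewrite mcoeffD mcoeffZ mulrDr monalgUD mulrCA; congr (_ + _)%R.
by rewrite scale_monalgU.
Qed.

Lemma free_compUU x y z c c' (q : qpath y z) (p : qpath x y) :
  free_comp (<< c *g q >> : free_hom y z) (<< c' *g p >> : free_hom x y) =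
    << c * c' *g path_comp q p >>.
Proof.
by rewrite (free_compEw msuppU_le msuppU_le) !big_seq_fset1 !mcoeffUU.
Qed.

Lemma free_comp0l x y z (f : free_hom x y) :
  free_comp (0 : free_hom y z) f = 0.
Proof. by rewrite /free_comp msupp0 big_seq_fset0. Qed.

Lemma free_comp0r x y z (g : free_hom y z) :
  free_comp g (0 : free_hom x y) = 0.
Proof.
by rewrite /free_comp big1 // => q _; rewrite msupp0 big_seq_fset0.
Qed.

Lemma free_hom_ind x y (P : free_hom x y -> Prop) :
  P 0 -> (forall c p g, P g -> P (c *: << p >> + g)) -> forall g, P g.
Proof.
move=> P0 PD g; rewrite (monalgE g).
elim: (enum_fset (msupp g)) => [|p s IHs]; rewrite ?big_nil // big_cons.
by rewrite -[g@_p]mulr1 -scale_monalgU; apply: PD.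
Qed.

Lemma free_compUUU w x y z (r : qpath y z) (q : qpath x y) (p : qpath w x) :
  free_comp (<< r >> : free_hom y z)
    (free_comp (<< q >> : free_hom x y) (<< p >> : free_hom w x)) =
  free_comp (free_comp (<< r >> : free_hom y z) (<< q >> : free_hom x y))
    (<< p >> : free_hom w x).
Proof.
rewrite [X in free_comp _ X = _]free_compUU [X in _ = free_comp X _]free_compUU.
rewrite [LHS]free_compUU [RHS]free_compUU mulrA.
by apply: (congr1 (fun p' => mkmalgU p' (1 * 1 * 1 : k))); apply: val_inj; rewrite /= catA.
Qed.

Lemma free_compUU_A w x y z (r : qpath y z) (q : qpath x y) (f : free_hom w x) :
  free_comp (<< r >> : free_hom y z) (free_comp (<< q >> : free_hom x y) f) =
  free_comp (free_comp (<< r >> : free_hom y z) (<< q >> : free_hom x y)) f.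
Proof.
elim/free_hom_ind: f => [|c p f IHf].
  by rewrite [X in free_comp _ X = _]free_comp0r [LHS]free_comp0r [RHS]free_comp0r.
rewrite [X in free_comp _ X = _]free_comp_linr [LHS]free_comp_linr.
rewrite [RHS]free_comp_linr.
exact: (congr2 (fun u v => c *: u + v) (free_compUUU r q p) IHf).
Qed.

Lemma free_compU_A w x y z (r : qpath y z) (g : free_hom x y) (f : free_hom w x) :
  free_comp (<< r >> : free_hom y z) (free_comp g f) =
  free_comp (free_comp (<< r >> : free_hom y z) g) f.
Proof.
elim/free_hom_ind: g => [|c q g IHg].
  rewrite [X in free_comp _ X = _]free_comp0l [LHS]free_comp0r.
  by rewrite [X in _ = free_comp X f]free_comp0r [RHS]free_comp0l.
rewrite [X in free_comp _ X = _]free_comp_linl [LHS]free_comp_linr.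
rewrite [X in _ = free_comp X f]free_comp_linr [RHS]free_comp_linl.
exact: (congr2 (fun u v => c *: u + v) (free_compUU_A r q f) IHg).
Qed.

Lemma free_compA w x y z (h : free_hom y z) (g : free_hom x y)
    (f : free_hom w x) :
  free_comp h (free_comp g f) = free_comp (free_comp h g) f.
Proof.
elim/free_hom_ind: h => [|c r h IHh].
  by rewrite [LHS]free_comp0l [X in _ = free_comp X f]free_comp0l [RHS]free_comp0l.
rewrite [LHS]free_comp_linl [X in _ = free_comp X f]free_comp_linl.
rewrite [RHS]free_comp_linl.
exact: (congr2 (fun u v => c *: u + v) (free_compU_A r g f) IHh).
Qed.

Definition free_id (x : vertex Q) : free_hom x x := << path_nil x >>.

Lemma free_comp1l x y (f : free_hom x y) : free_comp (free_id y) f = f.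
Proof.
elim/free_hom_ind: f => [|c p f IHf]; first by rewrite free_comp0r.
rewrite [LHS]free_comp_linr; apply: (congr2 (fun u v => c *: u + v) _ IHf).
rewrite [LHS]free_compUU mul1r.
by apply: (congr1 (fun p' => mkmalgU p' (1 : k))); apply: val_inj; rewrite /= cats0.
Qed.

Lemma free_comp1r x y (f : free_hom x y) : free_comp f (free_id x) = f.
Proof.
elim/free_hom_ind: f => [|c p f IHf]; first by rewrite free_comp0l.
rewrite [LHS]free_comp_linl; apply: (congr2 (fun u v => c *: u + v) _ IHf).
rewrite [LHS]free_compUU mul1r.
by apply: (congr1 (fun p' => mkmalgU p' (1 : k))); apply: val_inj.
Qed.

Definition free_cat : lincat k :=
  @LinCat k (vertex Q) free_hom free_id free_comp
    free_compA free_comp1l free_comp1r free_comp_linl free_comp_linr.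

(* Paths of length two are the compositions of two consecutive arrows. *)
Inductive consecutive_arrows_zero :
    forall x y : lobj free_cat, lhom x y -> lhom x y -> Prop :=
| ConsecutiveArrowsZero (x y : vertex Q) (p : qpath x y) :
    size (val p) = 2 ->
    @consecutive_arrows_zero x y (<< p >> : free_hom x y) 0.

End FreeLinearCategory.

Definition quiver_sum (Q Q' : quiver) : quiver := {|
  vertex := (vertex Q + vertex Q')%type;
  arrow := (arrow Q + arrow Q')%type;
  source := fun a =>
    match a with inl b => inl (source b) | inr b => inr (source b) end;
  target := fun a =>
    match a with inl b => inl (target b) | inr b => inr (target b) end |}.

(* The directed linear graph [0 -> 1 -> ... -> m - 1]. *)
Definition straightline_path (m : nat) : quiver := {|
  vertex := 'I_m;
  arrow := {p : 'I_m * 'I_m | p.2 == p.1.+1 :> nat};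
  source := fun a => (val a).1;
  target := fun a => (val a).2 |}.

(** * The quiver and the quiver presentations of an algebra *)

Section QuiverOfSplitBasic.
Variables (k : fieldType) (A : falgType k) (Q : quiver).

(* The vertices of [Q] index the idempotents [e]. *)
Definition is_quiver_at (e : vertex Q -> A) : Prop :=
  forall i j : vertex Q,
  exists b : arrows_between i j -> quotient_space (Rad A * Rad A)%VS,
    basis_of_set (fun v => exists2 x, x \in Rad A &
      v = class_mod (Rad A * Rad A)%VS (e j * x * e i)) b.

Definition is_quiver_of_split_basic : Prop :=
  exists2 e : vertex Q -> A,
    complete_primitive_orthogonal e & is_quiver_at e.

Definition is_presentation_of_split_basic (R : hom_relation (free_cat k Q)) :
    Prop :=
  exists (e : vertex Q -> A) (ce : complete_primitive_orthogonal e),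
    is_quiver_at e /\
    lincat_iso (quotient_cat (generated_congruence R))
               (algebra_cat (complete_idempotent ce)).

End QuiverOfSplitBasic.

Section MoritaEquivalence.
Variable k : fieldType.

(* A [k]-linear functor from left [A]-modules to left [B]-modules; [c : k]
   acts on modules through [c%:A]. *)
Record module_functor (A B : algType k) := ModuleFunctor {
  mf_obj :> lmodType A -> lmodType B;
  mf_map : forall M N : lmodType A,
    {linear M -> N} -> {linear mf_obj M -> mf_obj N};
  mf_id : forall M : lmodType A, mf_map (idfun : {linear M -> M}) =1 id;
  mf_comp : forall (M N P : lmodType A)
    (g : {linear N -> P}) (f : {linear M -> N}),
    mf_map (g \o f : {linear M -> P}) =1 mf_map g \o mf_map f;
  mf_linear : forall (M N : lmodType A) (c : k) (f g h : {linear M -> N}),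
    (forall m, h m = c%:A *: f m + g m) ->
    forall m, mf_map h m = c%:A *: mf_map f m + mf_map g m }.

(* A natural isomorphism from the identity functor to [G \o F]. *)
Definition unit_iso (A B : algType k)
    (F : module_functor A B) (G : module_functor B A) : Prop :=
  exists eta : forall M : lmodType A, {linear M -> G (F M)},
    (forall M, bijective (eta M)) /\
    (forall (M N : lmodType A) (f : {linear M -> N}) (m : M),
      eta N (f m) = mf_map G (mf_map F f) (eta M m)).

Definition morita_equivalent (A B : algType k) : Prop :=
  exists (F : module_functor A B) (G : module_functor B A),
    unit_iso F G /\ unit_iso G F.

Definition is_quiver_of (A : falgType k) (Q : quiver) : Prop :=
  exists B : falgType k,
    [/\ split_basic B, morita_equivalent A B & is_quiver_of_split_basic B Q].

Definition is_presentation_of (A : falgType k) (Q : quiver)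
    (R : hom_relation (free_cat k Q)) : Prop :=
  exists B : falgType k,
    [/\ split_basic B, morita_equivalent A B
      & is_presentation_of_split_basic B R].

End MoritaEquivalence.

(** * The monoid [OD n] *)

Section OrderDirected.
Variable n : nat.
Implicit Types f g : {ffun 'I_n -> 'I_n}.

Definition order_preserving f : bool :=
  [forall x1 : 'I_n, forall x2 : 'I_n, (x1 <= x2)%N ==> (f x1 <= f x2)%N].

Definition order_reversing f : bool :=
  [forall x1 : 'I_n, forall x2 : 'I_n, (x1 <= x2)%N ==> (f x2 <= f x1)%N].

Record OD := MkOD {
  od_fun :> {ffun 'I_n -> 'I_n};
  od_funP : order_preserving od_fun || order_reversing od_fun }.

HB.instance Definition _ := [isSub for od_fun].
HB.instance Definition _ := [Finite of OD by <:].

Lemma monoP f (r : rel nat) :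
  reflect (forall x1 x2 : 'I_n, (x1 <= x2)%N -> r (f x1) (f x2))
    [forall x1 : 'I_n, forall x2 : 'I_n, (x1 <= x2)%N ==> r (f x1) (f x2)].
Proof.
apply: (iffP forallP) => [fP x1 x2|fP x1].
  by move/forallP/(_ x2)/implyP: (fP x1).
by apply/forallP=> x2; apply/implyP/fP.
Qed.

Lemma od_id_subproof :
  order_preserving [ffun x => x] || order_reversing [ffun x => x].
Proof.
by apply/orP; left; apply/(monoP _ leq) => x1 x2; rewrite !ffunE.
Qed.

Lemma od_comp_subproof (f g : OD) :
  order_preserving [ffun x => f (g x)] || order_reversing [ffun x => f (g x)].
Proof.
case: f g => f fP [g gP] /=; apply/orP.
have pr h : order_preserving h || order_reversing h ->
    (forall x1 x2 : 'I_n, (x1 <= x2)%N -> (h x1 <= h x2)%N) \/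
    (forall x1 x2 : 'I_n, (x1 <= x2)%N -> (h x2 <= h x1)%N).
  by case/orP=> [/(monoP _ leq)|/(monoP _ geq)]; [left|right].
case: (pr f fP) (pr g gP) => Hf [] Hg.
- by left; apply/(monoP _ leq) => x1 x2 le; rewrite !ffunE; apply/Hf/Hg.
- by right; apply/(monoP _ geq) => x1 x2 le; rewrite !ffunE; apply/Hf/Hg.
- by right; apply/(monoP _ geq) => x1 x2 le; rewrite !ffunE; apply/Hf/Hg.
- by left; apply/(monoP _ leq) => x1 x2 le; rewrite !ffunE; apply/Hf/Hg.
Qed.

Definition od_one : OD := MkOD od_id_subproof.
Definition od_mul (f g : OD) : OD := MkOD (od_comp_subproof f g).

Lemma od_mulA : associative od_mul.
Proof. by move=> f g h; apply: val_inj; apply/ffunP=> x; rewrite !ffunE. Qed.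

Lemma od_mul1 : left_id od_one od_mul.
Proof. by move=> f; apply: val_inj; apply/ffunP=> x; rewrite !ffunE. Qed.

Lemma od_mul1r : right_id od_one od_mul.
Proof. by move=> f; apply: val_inj; apply/ffunP=> x; rewrite !ffunE. Qed.

HB.instance Definition _ := isMonoid.Build OD od_mulA od_mul1 od_mul1r.

End OrderDirected.

(** * The monoid algebra of [OD n] *)

Section MonoidAlgebra.
Variables (k : fieldType) (n : nat).

Definition OD_algebra := {ffun OD n -> k^o}.
HB.instance Definition _ := Vector.on OD_algebra.

Implicit Types f g h : OD_algebra.

Definition ma_one : OD_algebra := [ffun x : OD n => (x == 1%g)%:R].
Definition ma_mul f g : OD_algebra :=
  [ffun z : OD n =>
    \sum_(x : OD n) \sum_(y : OD n | (x * y)%g == z) f x * g y].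

Lemma ma_mulA : associative ma_mul.
Proof.
move=> f g h; apply/ffunP=> z; rewrite !ffunE.
transitivity (\sum_(x : OD n) \sum_(y : OD n) \sum_(t : OD n | (x * y * t)%g == z)
    f x * g y * h t).
  apply: eq_bigr => x _.
  under eq_bigr => w _ do rewrite ffunE mulr_sumr.
  rewrite exchange_big; apply: eq_bigr => y _ /=.
  under eq_bigr => w _ do rewrite mulr_sumr.
  rewrite (exchange_big_dep (fun t : OD n => (x * y * t)%g == z)) /=; last first.
    by move=> w t /eqP<- /eqP<-; rewrite mulgA.
  apply: eq_bigr => t xytz; rewrite (big_pred1 (y * t)%g) ?mulrA // => w.
  by apply/andP/eqP=> [[_ /eqP]|->]; rewrite ?mulgA.
transitivity (\sum_(w : OD n) \sum_(t : OD n | (w * t)%g == z)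
    \sum_(x : OD n) \sum_(y : OD n | (x * y)%g == w) f x * g y * h t); last first.
  apply: eq_bigr => w _; apply: eq_bigr => t _; rewrite ffunE mulr_suml.
  by apply: eq_bigr => x _; rewrite mulr_suml.
under [RHS]eq_bigr => w _ do rewrite exchange_big.
rewrite [RHS]exchange_big; apply: eq_bigr => x _ /=.
under [RHS]eq_bigr => w _.
  rewrite (exchange_big_dep xpredT) //=; over.
rewrite [RHS]exchange_big; apply: eq_bigr => y _ /=.
rewrite (exchange_big_dep xpredT) //=.
rewrite big_mkcond; apply: eq_bigr => t _.
rewrite big_mkcondl (big_pred1 (x * y)%g) => [|w]; last first.
  by rewrite /= eq_sym.
by [].
Qed.

Lemma ma_mul1 : left_id ma_one ma_mul.
Proof.
move=> f; apply/ffunP=> z; rewrite ffunE (bigD1 (1%g : OD n)) //=.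
rewrite [X in _ + X]big1 ?addr0 => [|x nx1]; last first.
  by apply: big1 => y _; rewrite ffunE (negPf nx1) mul0r.
by rewrite (big_pred1 z) => [|y]; rewrite ?ffunE ?eqxx ?mul1r // mul1g.
Qed.

Lemma ma_mul1r : right_id ma_one ma_mul.
Proof.
move=> f; apply/ffunP=> z; rewrite ffunE (bigD1 z) //=.
rewrite [X in _ + X]big1 ?addr0 => [|x nxz]; last first.
  apply: big1 => y /eqP xyz; rewrite ffunE; case: eqP xyz => [->|].
    by rewrite mulg1 => xz; rewrite xz eqxx in nxz.
  by rewrite mulr0.
rewrite (bigD1 (1%g : OD n)) ?mulg1 //= ffunE eqxx mulr1 big1 ?addr0 // => y.
by case/andP=> _ /negPf ny1; rewrite ffunE ny1 mulr0.
Qed.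

Lemma ma_mulDl : left_distributive ma_mul +%R.
Proof.
move=> f g h; apply/ffunP=> z; rewrite !ffunE -big_split.
apply: eq_bigr => x _; rewrite -big_split.
by apply: eq_bigr => y _; rewrite ffunE mulrDl.
Qed.

Lemma ma_mulDr : right_distributive ma_mul +%R.
Proof.
move=> f g h; apply/ffunP=> z; rewrite !ffunE -big_split.
apply: eq_bigr => x _; rewrite -big_split.
by apply: eq_bigr => y _; rewrite ffunE mulrDr.
Qed.

Lemma ma_one_neq0 : ma_one != 0.
Proof. by apply/eqP=> /ffunP/(_ 1%g)/eqP; rewrite !ffunE eqxx oner_eq0. Qed.

HB.instance Definition _ := GRing.Zmodule_isNzRing.Build OD_algebra
  ma_mulA ma_mul1 ma_mul1r ma_mulDl ma_mulDr ma_one_neq0.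

Lemma ma_scaleAl (a : k) f g : a *: (f * g) = a *: f * g.
Proof.
apply/ffunP=> z; rewrite !ffunE scaler_sumr; apply: eq_bigr => x _.
by rewrite scaler_sumr; apply: eq_bigr => y _; rewrite ffunE scalerAl.
Qed.

Lemma ma_scaleAr (a : k) f g : a *: (f * g) = f * (a *: g).
Proof.
apply/ffunP=> z; rewrite !ffunE scaler_sumr; apply: eq_bigr => x _.
by rewrite scaler_sumr; apply: eq_bigr => y _; rewrite ffunE scalerAr.
Qed.

HB.instance Definition _ :=
  GRing.LSemiModule_isLSemiAlgebra.Build k OD_algebra ma_scaleAl.
HB.instance Definition _ :=
  GRing.LSemiAlgebra_isSemiAlgebra.Build k OD_algebra ma_scaleAr.
HB.instance Definition _ := Algebra_isFalgebra.Build k OD_algebra.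

End MonoidAlgebra.

(* Main.v *)
From HB Require Import structures.
Require Import Defs.
From mathcomp Require Import all_boot all_order all_algebra all_field zify.
From mathcomp Require Import finmap boolp monalg.

Set Implicit Arguments.
Unset Strict Implicit.
Unset Printing Implicit Defensive.

Import GRing.Theory.
Local Open Scope ring_scope.

(** Let N be the normalized chain complex of the simplex with vertex set [n]:
    one generator for each nonempty face S, with the alternating boundary d.
    The monoid OD_n acts on it by simplicial maps. A map g sends S to g(S) up
    to sign if it is injective on S and to 0 otherwise, and d commutes with g
    once order-reversing maps act on faces of l points with the sign
    (-1)^(l(l-1)/2) of the permutation that reverses l points. A map which is
    both order-preserving and order-reversing is constant, so it kills the
    faces with at least two points; on these the action can also be multiplied
    by the orientation of g. So A = kOD_n acts on two complexes: N, with faces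
    of sizes 1, ..., n, and a twisted copy with faces of sizes 2, ..., n. Their
    sum is [chains], where the boolean tells the two copies apart.

    A face T without the least vertex 0 is the boundary of its cone 0 + T, up
    to faces that contain 0. Therefore an endomorphism of the graded complex is
    determined by its values on the cones S (the faces that contain 0), and
    these values can be any chains of the right degree. The main point is that
    A is the algebra of all these endomorphisms ([alg_act_inj] and
    [interpolation]):
    - the action is faithful ([od_faithful]). Because 2 is invertible, the two
      copies together see the order-preserving and the order-reversing part of
      an element of A separately. In each part, let S be the set of the least
      elements of the fibres of f; any g with g(S) = f(S) lies on a fixed side
      of f pointwise, so that the matrix of the action is triangular;
    - the pairs (S, T) of faces of equal size with S a cone, counted in both
      copies, are as many as the maps in OD_n, so that both sides have the same
      dimension: there is an f with S and T for its least fibre elements and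
      its image, order-preserving for a pair in N and order-reversing for a
      pair in the twisted copy ([exists_od]).

    Each of the two complexes is the direct sum of the pieces spanned by S and
    dS, for the cones S, and two pieces are isomorphic when they have the same
    size. Keep one piece for each size, say with the cone S_l for the size l.
    The endomorphisms of what is kept form a corner eAe with AeA = A. It has
    for basis the identities of the pieces and the maps S_l |-> d S_(l+1) from
    each piece to the next one, and two consecutive maps compose to d d = 0.
    So eAe is the radical square zero algebra of two straight lines, with n
    vertices for N and n - 1 for the twisted copy ([embed]).

    The remaining facts are general. A full corner eAe is Morita equivalent to
    A ([full_corner_morita]), and a radical square zero algebra of a quiver Q
    is split basic with quiver Q and is presented by killing all paths of
    length two ([split_basic_rsz], [rsz_is_quiver], [rsz_is_presentation]). *)

(** * Full corners and Morita equivalence *)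

(** An identification of [B] with the corner eAe, for e the image of 1; the
    last field says that the two-sided ideal AeA contains 1, with the witnesses
    that the inverse functors use as a finite system of coordinates. The
    projection a |-> eae is recorded with values in [B]. *)
Record full_corner (k : fieldType) (A B : algType k) := FullCorner {
  fc_emb : {linear B -> A};
  fc_embM : forall x y, fc_emb (x * y) = fc_emb x * fc_emb y;
  fc_emb_inj : injective fc_emb;
  fc_proj : A -> B;
  fc_projP : forall a, fc_emb (fc_proj a) = fc_emb 1 * a * fc_emb 1;
  fc_index : finType;
  fc_left : fc_index -> A;
  fc_right : fc_index -> A;
  fc_full : \sum_i fc_left i * fc_emb 1 * fc_right i = 1 }.

Section FullCornerTheory.
Variables (k : fieldType) (A B : algType k) (D : full_corner A B).
Local Notation phi := (fc_emb D).
Local Notation theta := (fc_proj D).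
Local Notation e := (phi 1).
Local Notation I := (fc_index D).
Local Notation x := (@fc_left _ _ _ D).
Local Notation y := (@fc_right _ _ _ D).

Lemma fc_idem : e * e = e.
Proof. by rewrite -fc_embM mulr1. Qed.

Lemma fc_proj_linear (c : k) a b : theta (c *: a + b) = c *: theta a + theta b.
Proof.
apply: (@fc_emb_inj _ _ _ D).
by rewrite fc_projP linearP !fc_projP mulrDr mulrDl -scalerAr -scalerAl.
Qed.

HB.instance Definition _ :=
  GRing.isLinear.Build k A B _ (fc_proj D) fc_proj_linear.

Lemma fc_proj_embl b a : theta (phi b * a) = b * theta a.
Proof.
apply: (@fc_emb_inj _ _ _ D).
by rewrite fc_projP fc_embM fc_projP !mulrA -!fc_embM mul1r mulr1.
Qed.

Lemma fc_proj_embr b a : theta (a * phi b) = theta a * b.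
Proof.
apply: (@fc_emb_inj _ _ _ D).
by rewrite fc_projP fc_embM fc_projP -!mulrA -!fc_embM mul1r mulr1.
Qed.

Lemma fc_emb_proj b : theta (phi b) = b.
Proof.
apply: (@fc_emb_inj _ _ _ D).
by rewrite fc_projP -!fc_embM mul1r mulr1.
Qed.

Lemma fc_proj1 : theta 1 = 1.
Proof. by rewrite -[theta 1]mul1r -fc_proj_embl mulr1 fc_emb_proj. Qed.

Lemma fc_proj_mul a b : theta a * theta b = theta (a * e * b).
Proof.
apply: (@fc_emb_inj _ _ _ D).
by rewrite fc_embM !fc_projP !mulrA -[_ * e * e]mulrA fc_idem.
Qed.

(** This is how the partition of unity [fc_full] is seen from [B]: matrices
    with entries [theta (y i * a * x j)] multiply like the elements a of [A],
    which makes [A] act on families of elements of a [B]-module. *)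
Lemma fc_proj_sum a b : \sum_i theta (a * x i) * theta (y i * b) = theta (a * b).
Proof.
under eq_bigr => i _ do rewrite fc_proj_mul.
rewrite -raddf_sum; congr theta.
rewrite -[a in RHS]mulr1 -(fc_full D) mulr_sumr mulr_suml.
by apply: eq_bigr => i _; rewrite !mulrA.
Qed.

(** ** From modules over the algebra to modules over its corner *)

Definition corner_fixed (M : lmodType A) : {pred M} := [pred m | e *: m == m].

Lemma corner_fixed_closed M : zmod_closed (@corner_fixed M).
Proof.
split=> [|m m']; rewrite !inE ?scaler0 // => /eqP em /eqP em'.
by rewrite scalerBr em em'.
Qed.
HB.instance Definition _ (M : lmodType A) :=
  GRing.isZmodClosed.Build M (@corner_fixed M)
  (@corner_fixed_closed M).

Definition corner_mod (M : lmodType A) := {m : M | m \in @corner_fixed M}.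
HB.instance Definition _ (M : lmodType A) := SubType.on (corner_mod M).
HB.instance Definition _ (M : lmodType A) := Choice.on (corner_mod M).
HB.instance Definition _ (M : lmodType A) :=
  [SubChoice_isSubZmodule of corner_mod M by <:].

Lemma corner_modP M (m : corner_mod M) : e *: val m = val m.
Proof. exact: eqP (valP m). Qed.

Lemma corner_scale_subproof M (b : B) (m : corner_mod M) :
  phi b *: val m \in @corner_fixed M.
Proof. by rewrite inE scalerA -fc_embM mul1r. Qed.

Definition corner_scale M b (m : corner_mod M) : corner_mod M :=
  Sub (phi b *: val m) (corner_scale_subproof b m).

Lemma corner_scaleA M a b (m : corner_mod M) :
  corner_scale a (corner_scale b m) = corner_scale (a * b) m.
Proof. by apply: val_inj; rewrite /= scalerA fc_embM. Qed.

Lemma corner_scale1 M : left_id 1 (@corner_scale M).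
Proof. by move=> m; apply: val_inj; rewrite /= corner_modP. Qed.

Lemma corner_scaleDr M : right_distributive (@corner_scale M) +%R.
Proof. by move=> b m m'; apply: val_inj; apply: scalerDr. Qed.

Lemma corner_scaleDl M (m : corner_mod M) :
  {morph (@corner_scale M)^~ m : a b / a + b}.
Proof. by move=> a b; apply: val_inj; rewrite /= raddfD scalerDl. Qed.

HB.instance Definition _ (M : lmodType A) :=
  GRing.Zmodule_isLmodule.Build B (corner_mod M)
  (@corner_scaleA M) (@corner_scale1 M) (@corner_scaleDr M) (@corner_scaleDl M).

Lemma corner_val_sum M (J : finType) (F : J -> corner_mod M) :
  sval (\sum_j F j) = \sum_j sval (F j).
Proof. exact: (raddf_sum (val : {additive corner_mod M -> M})). Qed.

Lemma corner_map_subproof (M N : lmodType A) (f : {linear M -> N})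
  (m : corner_mod M) : f (val m) \in @corner_fixed N.
Proof. by rewrite inE -linearZ /= corner_modP. Qed.

Definition corner_map (M N : lmodType A) (f : {linear M -> N}) (m : corner_mod M) :
  corner_mod N := Sub (f (val m)) (corner_map_subproof f m).

Lemma corner_map_linear (M N : lmodType A) (f : {linear M -> N}) : linear (corner_map f).
Proof.
by move=> b m m'; apply: val_inj; apply: linearP.
Qed.
HB.instance Definition _ (M N : lmodType A) (f : {linear M -> N}) :=
  GRing.isLinear.Build B (corner_mod M) (corner_mod N) _ (corner_map f)
    (corner_map_linear f).

Lemma fc_emb_scalar (c : k) (M : lmodType A) (m : corner_mod M) :
  phi c%:A *: val m = c%:A *: val m.
Proof. by rewrite linearZ /= -[in RHS](corner_modP m) scalerA mulr_algl. Qed.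

Lemma corner_map_id (M : lmodType A) : corner_map (idfun : {linear M -> M}) =1 id.
Proof. by move=> m; apply: val_inj. Qed.

Lemma corner_map_comp (M N P : lmodType A)
    (g : {linear N -> P}) (f : {linear M -> N}) :
  corner_map (g \o f : {linear M -> P}) =1 corner_map g \o corner_map f.
Proof. by move=> m; apply: val_inj. Qed.

Lemma corner_map_lin (M N : lmodType A) (c : k) (f g h : {linear M -> N}) :
  (forall m, h m = c%:A *: f m + g m) ->
  forall m, corner_map h m = c%:A *: corner_map f m + corner_map g m.
Proof.
move=> fgh m; apply: val_inj; rewrite /= fgh.
by congr (_ + _); rewrite -(fc_emb_scalar c (corner_map f m)).
Qed.

Definition corner_functor : module_functor A B :=
  @ModuleFunctor k A B corner_mod
    (fun M N f => corner_map f : {linear corner_mod M -> corner_mod N})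
    corner_map_id corner_map_comp corner_map_lin.

(** ** From modules over the corner to modules over the algebra *)

(** The module induced from the corner is Ae tensored with N over eAe. It is
    realized without tensor products: x_i e (tensor) v_i, summed over i, is
    recorded by its coordinates, and the families that occur are the fixed
    points of the idempotent matrix that represents 1. *)
Definition coords_act (N : lmodType B) a (v : {ffun I -> N}) : {ffun I -> N} :=
  [ffun i => \sum_j theta (y i * a * x j) *: v j].

Lemma coords_act_mul (N : lmodType B) a b (v : {ffun I -> N}) :
  coords_act a (coords_act b v) = coords_act (a * b) v.
Proof.
apply/ffunP=> i; rewrite !ffunE.
under eq_bigr => j _ do rewrite ffunE scaler_sumr.
rewrite exchange_big; apply: eq_bigr => j _ /=.
under eq_bigr => l _ do rewrite scalerA -[y l * b * x j]mulrA.
by rewrite -scaler_suml fc_proj_sum !mulrA.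
Qed.

Lemma coords_actDr (N : lmodType B) a (v w : {ffun I -> N}) :
  coords_act a (v + w) = coords_act a v + coords_act a w.
Proof.
apply/ffunP=> i; rewrite !ffunE -big_split; apply: eq_bigr => j _.
by rewrite ffunE scalerDr.
Qed.

Lemma coords_actDl (N : lmodType B) a b (v : {ffun I -> N}) :
  coords_act (a + b) v = coords_act a v + coords_act b v.
Proof.
apply/ffunP=> i; rewrite !ffunE -big_split; apply: eq_bigr => j _.
by rewrite mulrDr mulrDl raddfD scalerDl.
Qed.

Lemma coords_act_scalar (N : lmodType B) (c : k) (v : {ffun I -> N}) :
  coords_act c%:A v = [ffun i => c%:A *: coords_act 1 v i].
Proof.
apply/ffunP=> i; rewrite !ffunE scaler_sumr; apply: eq_bigr => j _.
by rewrite mulr_algr -scalerAl linearZ /= mulr1 scalerA mulr_algl.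
Qed.

Definition coords_fixed (N : lmodType B) : {pred {ffun I -> N}} :=
  [pred v | coords_act 1 v == v].

Lemma coords_fixed_closed N : zmod_closed (@coords_fixed N).
Proof.
split=> [|v w]; rewrite !inE.
  by apply/eqP/ffunP=> i; rewrite !ffunE big1 // => j _; rewrite ffunE scaler0.
move=> /eqP ev /eqP ew; apply/eqP; apply: (addIr w).
by rewrite -{2}ew -coords_actDr subrK ev.
Qed.
HB.instance Definition _ (N : lmodType B) :=
  GRing.isZmodClosed.Build {ffun I -> N} (@coords_fixed N)
    (@coords_fixed_closed N).

Definition coords_mod (N : lmodType B) :=
  {v : {ffun I -> N} | v \in @coords_fixed N}.
HB.instance Definition _ (N : lmodType B) := SubType.on (coords_mod N).
HB.instance Definition _ (N : lmodType B) := Choice.on (coords_mod N).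
HB.instance Definition _ (N : lmodType B) :=
  [SubChoice_isSubZmodule of coords_mod N by <:].

Lemma coords_modP (N : lmodType B) (v : coords_mod N) :
  coords_act 1 (val v) = val v.
Proof. exact: eqP (valP v). Qed.

Lemma coords_scale_subproof (N : lmodType B) a (v : {ffun I -> N}) :
  coords_act a v \in @coords_fixed N.
Proof. by rewrite inE coords_act_mul mul1r. Qed.

Definition coords_scale (N : lmodType B) a (v : coords_mod N) : coords_mod N :=
  Sub (coords_act a (val v)) (coords_scale_subproof a (val v)).

Lemma coords_scaleA (N : lmodType B) a b (v : coords_mod N) :
  coords_scale a (coords_scale b v) = coords_scale (a * b) v.
Proof. by apply: val_inj; apply: coords_act_mul. Qed.

Lemma coords_scale1 (N : lmodType B) : left_id 1 (@coords_scale N).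
Proof. by move=> v; apply: val_inj; apply: coords_modP. Qed.

Lemma coords_scaleDr (N : lmodType B) : right_distributive (@coords_scale N) +%R.
Proof. by move=> a v w; apply: val_inj; apply: coords_actDr. Qed.

Lemma coords_scaleDl (N : lmodType B) (v : coords_mod N) :
  {morph (@coords_scale N)^~ v : a b / a + b}.
Proof. by move=> a b; apply: val_inj; apply: coords_actDl. Qed.

HB.instance Definition _ (N : lmodType B) :=
  GRing.Zmodule_isLmodule.Build A (coords_mod N)
    (@coords_scaleA N) (@coords_scale1 N) (@coords_scaleDr N) (@coords_scaleDl N).

Lemma coords_act_map (M N : lmodType B) (f : {linear M -> N}) a
    (v : {ffun I -> M}) :
  coords_act a [ffun i => f (v i)] = [ffun i => f (coords_act a v i)].
Proof.
apply/ffunP=> i; rewrite !ffunE linear_sum; apply: eq_bigr => j _ /=.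
by rewrite ffunE linearZ.
Qed.

Lemma coords_map_subproof (M N : lmodType B) (f : {linear M -> N})
    (v : coords_mod M) :
  [ffun i => f (val v i)] \in @coords_fixed N.
Proof. by rewrite inE coords_act_map coords_modP. Qed.

Definition coords_map (M N : lmodType B) (f : {linear M -> N})
    (v : coords_mod M) : coords_mod N :=
  Sub [ffun i => f (val v i)] (coords_map_subproof f v).

Lemma coords_map_linear (M N : lmodType B) (f : {linear M -> N}) :
  linear (coords_map f).
Proof.
move=> a v w; apply: val_inj; apply/ffunP=> i; rewrite /= coords_act_map !ffunE.
by rewrite linearD.
Qed.
HB.instance Definition _ (M N : lmodType B) (f : {linear M -> N}) :=
  GRing.isLinear.Build A (coords_mod M) (coords_mod N) _ (coords_map f)
    (coords_map_linear f).

Lemma coords_map_id (M : lmodType B) : coords_map (idfun : {linear M -> M}) =1 id.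
Proof. by move=> v; apply: val_inj; apply/ffunP=> i; rewrite /= !ffunE. Qed.

Lemma coords_map_comp (M N P : lmodType B)
    (g : {linear N -> P}) (f : {linear M -> N}) :
  coords_map (g \o f : {linear M -> P}) =1 coords_map g \o coords_map f.
Proof. by move=> v; apply: val_inj; apply/ffunP=> i; rewrite /= !ffunE. Qed.

Lemma coords_map_lin (M N : lmodType B) (c : k) (f g h : {linear M -> N}) :
  (forall m, h m = c%:A *: f m + g m) ->
  forall v, coords_map h v = c%:A *: coords_map f v + coords_map g v.
Proof.
move=> fgh v; apply: val_inj; apply/ffunP=> i; rewrite /= coords_act_scalar.
by rewrite coords_act_map coords_modP !ffunE fgh.
Qed.

Definition coords_functor : module_functor B A :=
  @ModuleFunctor k B A coords_mod
    (fun M N f => coords_map f : {linear coords_mod M -> coords_mod N})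
    coords_map_id coords_map_comp coords_map_lin.

(** ** The two functors are inverse to each other *)

Lemma corner_unit_subproof1 (M : lmodType A) (a : A) (m : M) :
  (e * a) *: m \in @corner_fixed M.
Proof. by rewrite inE scalerA mulrA fc_idem. Qed.

Definition to_corner (M : lmodType A) (a : A) (m : M) : corner_mod M :=
  Sub ((e * a) *: m) (corner_unit_subproof1 a m).

Lemma to_coords_subproof (M : lmodType A) (m : M) :
  [ffun i => to_corner (y i) m] \in @coords_fixed (corner_mod M).
Proof.
rewrite inE; apply/eqP/ffunP=> i; rewrite !ffunE; apply: val_inj.
rewrite /= corner_val_sum.
transitivity ((e * y i * \sum_j x j * e * y j) *: m); last first.
  by rewrite fc_full mulr1.
rewrite mulr_sumr scaler_suml; apply: eq_bigr => j _.
by rewrite ffunE /= scalerA fc_projP !mulrA mulr1 -[_ * e * e]mulrA fc_idem.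
Qed.

(** The coordinates of m are the e y_i m, and m is recovered from them as the
    sum of the x_i e y_i m. *)
Definition to_coords (M : lmodType A) (m : M) : coords_mod (corner_mod M) :=
  Sub [ffun i => to_corner (y i) m] (to_coords_subproof m).

Lemma to_coords_linear (M : lmodType A) : linear (@to_coords M).
Proof.
move=> a m m'; apply: val_inj; apply/ffunP=> i; rewrite /= !ffunE.
apply: val_inj; rewrite /= corner_val_sum.
rewrite scalerDr scalerA; congr (_ + _).
transitivity ((e * y i * a * \sum_j x j * e * y j) *: m).
  by rewrite fc_full mulr1.
rewrite mulr_sumr scaler_suml; apply: eq_bigr => j _.
by rewrite ffunE /= scalerA fc_projP !mulrA -[_ * e * e]mulrA fc_idem.
Qed.
HB.instance Definition _ (M : lmodType A) :=
  GRing.isLinear.Build A M (coords_mod (corner_mod M)) _ (@to_coords M)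
    (@to_coords_linear M).

Definition of_coords (M : lmodType A) (v : coords_mod (corner_mod M)) : M :=
  \sum_i x i *: val (val v i).

Lemma to_coordsK (M : lmodType A) : cancel (@to_coords M) (@of_coords M).
Proof.
move=> m; rewrite -[RHS]scale1r -(fc_full D) scaler_suml; apply: eq_bigr => i _.
by rewrite /= ffunE /= scalerA mulrA.
Qed.

Lemma of_coordsK (M : lmodType A) : cancel (@of_coords M) (@to_coords M).
Proof.
move=> v; apply: val_inj; rewrite -[RHS]coords_modP /=; apply/ffunP=> i.
rewrite !ffunE; apply: val_inj; rewrite /= corner_val_sum scaler_sumr.
apply: eq_bigr => j _ /=.
by rewrite mulr1 fc_projP -[in LHS]corner_modP !scalerA !mulrA.
Qed.

Lemma coords_unit : unit_iso corner_functor coords_functor.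
Proof.
exists (fun M : lmodType A =>
  @to_coords M : {linear M -> coords_mod (corner_mod M)}); split=> [M|M N f m].
  by exists (@of_coords M); [exact: to_coordsK|exact: of_coordsK].
apply: val_inj; apply/ffunP=> i; rewrite /= !ffunE; apply: val_inj.
by rewrite /= linearZ.
Qed.

Lemma from_corner_subproof1 (N : lmodType B) (n : N) :
  [ffun i => theta (y i) *: n] \in @coords_fixed N.
Proof.
rewrite inE; apply/eqP/ffunP=> i; rewrite !ffunE.
under eq_bigr => j _ do rewrite ffunE scalerA -[y j]mulr1.
by rewrite -scaler_suml fc_proj_sum !mulr1.
Qed.

Definition from_corner1 (N : lmodType B) (n : N) : coords_mod N :=
  Sub [ffun i => theta (y i) *: n] (from_corner_subproof1 n).

Lemma from_corner1_scale (N : lmodType B) (n : N) b :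
  phi b *: from_corner1 n = from_corner1 (b *: n).
Proof.
apply: val_inj; apply/ffunP=> i; rewrite /= !ffunE.
under eq_bigr => j _ do rewrite ffunE scalerA -[y j]mulr1.
by rewrite -scaler_suml fc_proj_sum !mulr1 fc_proj_embr scalerA.
Qed.

Lemma from_corner_subproof (N : lmodType B) (n : N) :
  from_corner1 n \in @corner_fixed (coords_mod N).
Proof. by rewrite inE from_corner1_scale scale1r. Qed.

(** An element n of a [B]-module becomes e (tensor) n, whose coordinates are
    the [theta (y i) *: n]. *)
Definition from_corner (N : lmodType B) (n : N) : corner_mod (coords_mod N) :=
  Sub (from_corner1 n) (from_corner_subproof n).

Lemma from_corner_linear (N : lmodType B) : linear (@from_corner N).
Proof.
move=> b n n'; apply: val_inj; rewrite /= from_corner1_scale.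
by apply: val_inj; apply/ffunP=> i; rewrite /= !ffunE scalerDr.
Qed.
HB.instance Definition _ (N : lmodType B) :=
  GRing.isLinear.Build B N (corner_mod (coords_mod N)) _ (@from_corner N)
    (@from_corner_linear N).

Definition to_module (N : lmodType B) (v : corner_mod (coords_mod N)) : N :=
  \sum_j theta (x j) *: val (val v) j.

Lemma from_cornerK (N : lmodType B) : cancel (@from_corner N) (@to_module N).
Proof.
move=> n; rewrite /to_module /=.
under eq_bigr => j _ do rewrite ffunE scalerA -[x j]mul1r -[y j]mulr1.
by rewrite -scaler_suml fc_proj_sum mulr1 fc_proj1 scale1r.
Qed.

Lemma to_moduleK (N : lmodType B) : cancel (@to_module N) (@from_corner N).
Proof.
move=> v; apply: val_inj; rewrite -[RHS]corner_modP.
apply: val_inj; apply/ffunP=> i; rewrite /= !ffunE scaler_sumr.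
apply: eq_bigr => j _.
by rewrite scalerA fc_proj_mul.
Qed.

Lemma corner_unit : unit_iso coords_functor corner_functor.
Proof.
exists (fun N : lmodType B =>
  @from_corner N : {linear N -> corner_mod (coords_mod N)}); split=> [N|M N f m].
  by exists (@to_module N); [exact: from_cornerK|exact: to_moduleK].
apply: val_inj; apply: val_inj; apply/ffunP=> i; rewrite /= !ffunE.
by rewrite linearZ.
Qed.

End FullCornerTheory.

Theorem full_corner_morita (k : fieldType) (A B : algType k) :
  full_corner A B -> morita_equivalent A B.
Proof.
move=> D; exists (corner_functor D), (coords_functor D).
by split; [exact: coords_unit|exact: corner_unit].
Qed.

(** * The radical square zero algebra of a quiver *)

(** The path algebra of [Q] modulo the paths of length two has the vertices and
    the arrows of [Q] for basis. Algebras are nonzero here, whence the parameter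
    [v0], which only witnesses that [Q] has a vertex. *)
Definition rad_sq_zero (k : fieldType) (Q : quiver) (v0 : vertex Q) :=
  {ffun (vertex Q + arrow Q)%type -> k^o}.
HB.instance Definition _ k Q (v0 : vertex Q) := Vector.on (rad_sq_zero k v0).

Lemma scale_one (k : fieldType) (c : k) : c *: (1 : k^o) = c.
Proof. exact: mulr1. Qed.

Section RadicalSquareZero.
Variables (k : fieldType) (Q : quiver) (v0 : vertex Q).
Local Notation B := (rad_sq_zero k v0).
Implicit Types f g h : B.

Definition rsz_one : B := [ffun z => if z is inl _ then 1 else 0].
(** In a product an arrow survives only next to an idempotent: that of its
    target on its left, that of its source on its right. *)
Definition rsz_mul f g : B :=
  [ffun z => match z with
   | inl v => f (inl v) * g (inl v)
   | inr a => f (inl (target a)) * g (inr a) + f (inr a) * g (inl (source a))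
   end].

Lemma rsz_mulA : associative rsz_mul.
Proof.
move=> f g h; apply/ffunP=> -[v|a]; rewrite !ffunE ?mulrA //.
by rewrite mulrDr mulrDl !mulrA addrA.
Qed.

Lemma rsz_mul1 : left_id rsz_one rsz_mul.
Proof.
by move=> f; apply/ffunP=> -[v|a]; rewrite !ffunE ?mul0r ?addr0 mul1r.
Qed.

Lemma rsz_mul1r : right_id rsz_one rsz_mul.
Proof.
by move=> f; apply/ffunP=> -[v|a]; rewrite !ffunE ?mulr0 ?add0r mulr1.
Qed.

Lemma rsz_mulDl : left_distributive rsz_mul +%R.
Proof.
by move=> f g h; apply/ffunP=> -[v|a]; rewrite !ffunE !mulrDl // addrACA.
Qed.

Lemma rsz_mulDr : right_distributive rsz_mul +%R.
Proof.
by move=> f g h; apply/ffunP=> -[v|a]; rewrite !ffunE !mulrDr // addrACA.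
Qed.

Lemma rsz_one_neq0 : rsz_one != 0.
Proof. by apply/eqP=> /ffunP/(_ (inl v0))/eqP; rewrite !ffunE oner_eq0. Qed.

HB.instance Definition _ := GRing.Zmodule_isNzRing.Build B
  rsz_mulA rsz_mul1 rsz_mul1r rsz_mulDl rsz_mulDr rsz_one_neq0.

Lemma rsz_scaleAl (c : k) f g : c *: (f * g) = c *: f * g.
Proof.
apply/ffunP=> -[v|a]; rewrite !ffunE ?scalerAl // scalerDr !scalerAl //.
Qed.

Lemma rsz_scaleAr (c : k) f g : c *: (f * g) = f * (c *: g).
Proof.
apply/ffunP=> -[v|a]; rewrite !ffunE ?scalerAr // scalerDr !scalerAr //.
Qed.

HB.instance Definition _ :=
  GRing.LSemiModule_isLSemiAlgebra.Build k B rsz_scaleAl.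
HB.instance Definition _ :=
  GRing.LSemiAlgebra_isSemiAlgebra.Build k B rsz_scaleAr.
HB.instance Definition _ := Algebra_isFalgebra.Build k B.

Lemma rsz1E z : (1 : B) z = if z is inl _ then 1 else 0.
Proof. by rewrite ffunE. Qed.

Lemma rszME f g z : (f * g) z = match z with
   | inl v => f (inl v) * g (inl v)
   | inr a => f (inl (target a)) * g (inr a) + f (inr a) * g (inl (source a))
   end.
Proof. by rewrite ffunE. Qed.

Lemma rsz_coefP (V : lmodType k) c f g z (w : V) :
  (c *: f + g) z *: w = c *: (f z *: w) + g z *: w.
Proof. by rewrite scalerA -scalerDl; congr (_ *: _); rewrite !ffunE. Qed.

Definition rsz_basis (z : vertex Q + arrow Q) : B := [ffun z' => (z' == z)%:R].

Local Notation ev v := (rsz_basis (inl v)).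
Local Notation ar a := (rsz_basis (inr a)).

Lemma rsz_sum f : f = \sum_v f (inl v) *: ev v + \sum_a f (inr a) *: ar a.
Proof.
apply/ffunP=> z; rewrite ffunE !sum_ffunE.
case: z => [v|a].
  rewrite (bigD1 v) //= !ffunE eqxx scale_one [X in _ + X + _]big1 => [|w /negPf nwv].
    by rewrite addr0 big1 ?addr0 // => b _; rewrite !ffunE scaler0.
  by rewrite !ffunE (inj_eq inl_inj) eq_sym nwv scaler0.
rewrite big1 => [|w _]; last by rewrite !ffunE scaler0.
rewrite add0r (bigD1 a) //= !ffunE eqxx scale_one big1 ?addr0 // => b /negPf nba.
by rewrite !ffunE (inj_eq inr_inj) eq_sym nba scaler0.
Qed.

(** ** The radical *)

Definition rad_rsz f := forall v, f (inl v) = 0.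

Lemma rad_rszM f g : rad_rsz f -> rad_rsz g -> f * g = 0.
Proof.
by move=> f0 g0; apply/ffunP=> -[v|a]; rewrite !ffunE !(f0, g0, mul0r, mulr0) // addr0.
Qed.

Definition rsz_coef v f : k^o := f (inl v).
Lemma rsz_coef_is_linear v : linear (rsz_coef v).
Proof. by move=> c f g; rewrite /rsz_coef !ffunE. Qed.
HB.instance Definition _ v :=
  GRing.isLinear.Build k B k^o _ (rsz_coef v) (rsz_coef_is_linear v).

Definition rsz_at v : 'Hom(B, k^o) := linfun (rsz_coef v).

Lemma mem_ker_at v f : (f \in lker (rsz_at v)) = (f (inl v) == 0).
Proof. by rewrite memv_ker lfunE. Qed.

(** It has codimension one. *)
Lemma ker_at_maximal v : maximal_left_ideal (lker (rsz_at v)).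
Proof.
split=> [a x||U' leftU' sub].
- by rewrite !mem_ker_at rszME => /eqP->; rewrite mulr0.
- by move=> /vspaceP/(_ 1); rewrite memvf mem_ker_at rsz1E oner_eq0.
have [sub'|/subvPn[u uU']] := boolP (U' <= lker (rsz_at v))%VS.
  by left; apply/eqP; rewrite eqEsubv sub' sub.
rewrite mem_ker_at => u0; right.
apply/vspaceP=> w; rewrite memvf.
have -> : w = (w - (w (inl v) / u (inl v)) *: u) + (w (inl v) / u (inl v)) *: u.
  by rewrite subrK.
rewrite memvD ?memvZ // (subvP sub) // mem_ker_at !ffunE.
by rewrite -[X in _ - X]/(w (inl v) / u (inl v) * u (inl v)) divfK // subrr.
Qed.

(** If a maximal left ideal U did not contain the span J of the arrows, U + J
    would be everything, and 1 = u + j with j nilpotent would make u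
    invertible. *)
Lemma rad_rsz_maximal f U : rad_rsz f -> maximal_left_ideal U -> f \in U.
Proof.
move=> f0 [leftU nfull maxU].
pose J := (\bigcap_v lker (rsz_at v))%VS.
have inJ g : reflect (rad_rsz g) (g \in J).
  apply: (iffP idP) => [|g0].
    rewrite memvE => /subv_bigcapP gJ v; apply/eqP.
    by rewrite -mem_ker_at memvE gJ.
  by rewrite memvE; apply/subv_bigcapP => v _; rewrite -memvE mem_ker_at g0.
have [] := maxU (U + J)%VS.
- move=> a x /memv_addP[u uU [j /inJ jJ ->]]; rewrite mulrDr memv_add ?leftU //.
  by apply/inJ => v; rewrite rszME jJ mulr0.
- exact: addvSl.
- by move=> <-; apply: subvP (addvSr _ _) _ _; apply/inJ.
move=> full; case: nfull; apply/vspaceP=> w; rewrite memvf.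
have /memv_addP[u uU [j /inJ jJ e1]] : 1 \in (U + J)%VS by rewrite full memvf.
have u_inv : (1 + j) * u = 1.
  have -> : u = 1 - j by apply/eqP; rewrite eq_sym subr_eq -e1.
  by rewrite mulrBr mulr1 mulrDl mul1r (rad_rszM jJ jJ) addr0 addrK.
by rewrite -[w]mulr1 -u_inv mulrA leftU.
Qed.

Lemma mem_Rad_rsz f : f \in Rad B <-> rad_rsz f.
Proof.
split=> [/RadP fR v|f0]; last by apply/RadP => U; apply: rad_rsz_maximal.
by apply/eqP; rewrite -mem_ker_at; apply: fR; apply: ker_at_maximal.
Qed.

Lemma Rad_rsz_sq : (Rad B * Rad B)%VS = 0%VS.
Proof.
apply/eqP; rewrite -subv0; apply/prodvP=> f g /mem_Rad_rsz f0 /mem_Rad_rsz g0.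
by rewrite (rad_rszM f0 g0) mem0v.
Qed.

Lemma class_mod_eq (V : vectType k) (W : {vspace V}) x y :
  class_mod W x = class_mod W y <-> x - y \in W.
Proof. exact: (lquot_piP (vs_equiv W) x y). Qed.

Lemma class_modD (V : vectType k) (W : {vspace V}) c x y :
  class_mod W (c *: x + y) = c *: class_mod W x + class_mod W y.
Proof. exact: linearP. Qed.

Lemma class_mod_ind (V : vectType k) (W : {vspace V}) (P : quotient_space W -> Prop) :
  (forall x, P (class_mod W x)) -> forall q, P q.
Proof. exact: lquot_ind. Qed.

Definition rsz_top (q : quotient_space (Rad B)) : {ffun 'I_#|vertex Q| -> k^o} :=
  [ffun i => (repr q : B) (inl (enum_val i))].

Lemma rsz_top_class f :
  rsz_top (class_mod (Rad B) f) = [ffun i => f (inl (enum_val i))].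
Proof.
apply/ffunP=> i; rewrite !ffunE.
have /mem_Rad_rsz/(_ (enum_val i)) := repr_lquot_pi (vs_equiv (Rad B)) f.
by rewrite !ffunE => /subr0_eq.
Qed.

Lemma rsz_top_linear : linear rsz_top.
Proof.
move=> c q r; elim/class_mod_ind: q => f; elim/class_mod_ind: r => g.
rewrite -class_modD !rsz_top_class.
by apply/ffunP=> i; rewrite !ffunE.
Qed.
HB.instance Definition _ := GRing.isLinear.Build k (quotient_space (Rad B))
  {ffun 'I_#|vertex Q| -> k^o} _ rsz_top rsz_top_linear.

Lemma split_basic_rsz : split_basic B.
Proof.
exists #|vertex Q|, (rsz_top : {linear _ -> _}); split.
- pose lift (w : {ffun 'I_#|vertex Q| -> k^o}) : B :=
    [ffun z => if z is inl v then w (enum_rank v) else 0].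
  exists (fun w => class_mod (Rad B) (lift w)) => [q|w].
    elim/class_mod_ind: q => f; rewrite /= rsz_top_class.
    apply/class_mod_eq/mem_Rad_rsz => v.
    by rewrite !ffunE enum_rankK subrr.
  by rewrite /= rsz_top_class; apply/ffunP=> i; rewrite !ffunE enum_valK.
- by rewrite /= rsz_top_class; apply/ffunP=> i; rewrite !ffunE.
- by move=> f g; rewrite /= !rsz_top_class; apply/ffunP=> i; rewrite !ffunE.
Qed.

(** ** The quiver *)

Lemma rsz_corner v w f : ev w * f * ev v =
  [ffun z => match z with
   | inl u => if (u == v) && (u == w) then f (inl u) else 0
   | inr a => if (source a == v) && (target a == w) then f (inr a) else 0
   end].
Proof.
apply/ffunP=> -[u|a]; rewrite !(rszME, ffunE) !(inj_eq inl_inj) //=.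
  by case: (u == w); case: (u == v); rewrite ?(mul1r, mulr1, mul0r, mulr0).
rewrite mulr0 add0r mul0r addr0.
by case: (source a == v); case: (target a == w);
  rewrite ?(mul1r, mulr1, mul0r, mulr0).
Qed.

(** Orthogonal idempotents y and z that add up to the idempotent of v have
    coordinates 0 and 1 at v in some order, and 0 at the other vertices. One of
    the two then lies in the radical, where the only idempotent is 0. *)
Lemma rsz_complete : complete_primitive_orthogonal (fun v => ev v).
Proof.
have EE v w : ev v * ev w = if v == w then ev v else 0.
  apply/ffunP=> -[u|a]; rewrite rszME !(ffunE, inj_eq inl_inj) /=; last first.
    by case: ifP => _; rewrite ?ffunE mulr0 mul0r addr0.
  case: (eqVneq v w) => [<-|nvw]; rewrite !ffunE ?(inj_eq inl_inj).
    by case: eqP; rewrite ?mulr1 ?mulr0.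
  by case: (eqVneq u v) => [->|_]; rewrite ?mul0r // (negPf nvw) mulr0.
split=> [v|v w /negPf nvw|].
- split; first by rewrite /idempotent_elt EE eqxx.
    by move=> /ffunP/(_ (inl v))/eqP; rewrite !ffunE eqxx oner_eq0.
  move=> y z yy zz yz zy eyz.
  have rad0 g : idempotent_elt g -> rad_rsz g -> g = 0.
    by move=> gg g0; rewrite -gg rad_rszM.
  have at_w w : y (inl w) + z (inl w) = (w == v)%:R.
    by have /ffunP/(_ (inl w)) := eyz; rewrite !ffunE (inj_eq inl_inj).
  have yz_w w : y (inl w) * z (inl w) = 0.
    by have /ffunP/(_ (inl w)) := yz; rewrite rszME ffunE.
  have off w : w != v -> (y (inl w) = 0) /\ (z (inl w) = 0).
    move=> /negPf nwv; have := at_w w; rewrite nwv => /eqP.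
    rewrite addr_eq0 => /eqP eyw; have /eqP := yz_w w; rewrite eyw mulNr oppr_eq0.
    by rewrite -expr2 expf_eq0 /= => /eqP ->; rewrite oppr0.
  have /eqP := yz_w v; rewrite mulf_eq0 => /orP[]/eqP g0; [left|right];
    apply: rad0 => // w; by case: (eqVneq w v) => [->//|/off[]].
- by rewrite EE nvw.
apply/ffunP=> -[v|a]; rewrite sum_ffunE ffunE /=; last first.
  by apply: big1 => w _; rewrite ffunE.
rewrite (bigD1 v) //= ffunE eqxx big1 ?addr0 // => w nwv.
by rewrite ffunE (inj_eq inl_inj) eq_sym (negPf nwv).
Qed.

Lemma rsz_is_quiver : is_quiver_at (fun v => ev v).
Proof.
move=> v w.
pose b (a : arrows_between v w) := class_mod (Rad B * Rad B)%VS (ar (val a)).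
have bE (c : {ffun arrows_between v w -> k}) :
  \sum_a c a *: b a = class_mod (Rad B * Rad B)%VS (\sum_a c a *: ar (val a)).
  rewrite /class_mod linear_sum; apply: eq_bigr => a _.
  by rewrite linearZ.
exists b; split=> [a|_ [f /mem_Rad_rsz f0 ->]].
  exists (ar (val a)); first by apply/mem_Rad_rsz => u; rewrite ffunE.
  congr class_mod; rewrite rsz_corner; apply/ffunP=> -[u|a']; rewrite !ffunE /=.
    by rewrite if_same.
  case: (eqVneq a' (val a)) => [->|na]; 
    last by rewrite (inj_eq inr_inj) (negPf na) if_same.
  by rewrite (valP a).
have classE (c : {ffun arrows_between v w -> k}) :
    class_mod (Rad B * Rad B)%VS (ev w * f * ev v) = \sum_a c a *: b a <->
    c = [ffun a => f (inr (val a))].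
  rewrite bE class_mod_eq Rad_rsz_sq memv0 subr_eq0.
  have sumE a : (\sum_a' c a' *: ar (val a')) (inr (val a)) = c a.
    rewrite sum_ffunE (bigD1 a) //= !ffunE eqxx scale_one big1 ?addr0 // => a' na'.
    by rewrite !ffunE (inj_eq inr_inj) eq_sym (inj_eq val_inj) (negPf na') scaler0.
  split=> [/eqP eqf|->].
    apply/ffunP=> a; rewrite -sumE -eqf rsz_corner !ffunE.
    by rewrite (valP a).
  apply/eqP; rewrite rsz_corner; apply/ffunP=> -[u|a]; rewrite sum_ffunE !ffunE.
    rewrite f0 if_same big1 // => a _; by rewrite !ffunE scaler0.
  case: ifP => Pa.
    rewrite (bigD1 (Sub a Pa : arrows_between v w)) //= !ffunE eqxx scale_one.
    rewrite big1 ?addr0 // => a' na'; rewrite !ffunE (inj_eq inr_inj).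
    case: eqP => [eaa|]; last by rewrite scaler0.
    by case/eqP: na'; apply: val_inj.
  rewrite big1 // => a' _; rewrite !ffunE (inj_eq inr_inj).
  case: eqP => [eaa|]; last by rewrite scaler0.
  by rewrite eaa (valP a') in Pa.
by exists [ffun a => f (inr (val a))]; split=> [|c /classE->//]; apply/classE.
Qed.

End RadicalSquareZero.

(** * Presentation by the compositions of two arrows *)

Section RadicalSquareZeroPresentation.
Variables (k : fieldType) (Q : quiver) (v0 : vertex Q).
Local Notation B := (rad_sq_zero k v0).
Local Notation ev v := (rsz_basis k v0 (inl v)).
Local Notation ar a := (rsz_basis k v0 (inr a)).
Local Notation R := (@consecutive_arrows_zero k Q).
Local Notation FC := (free_cat k Q).

Definition to_qpath x y (s : seq (arrow Q)) (sP : is_qpath x y s) : qpath x y :=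
  exist (fun s' => is_qpath x y s') s sP.

(** Paths of length at most one are addressed by their sequence of arrows, so
    that the coefficients of loops and non-loops are treated alike: a sequence
    which is not a path from x to y has coefficient 0. *)
Definition path_coef x y (s : seq (arrow Q)) (f : free_hom k x y) : k :=
  oapp (fun p : {p : seq (arrow Q) | is_qpath x y p} => f@_(p : qpath x y)) 0
    (insub s).

Lemma path_coefP x y s c (f g : free_hom k x y) :
  path_coef s (c *: f + g) = c * path_coef s f + path_coef s g.
Proof.
rewrite /path_coef; case: insubP => [p _ _|_] /=; last by rewrite mulr0 addr0.
by rewrite mcoeffD mcoeffZ.
Qed.

Lemma path_coefU x y s (p : qpath x y) :
  path_coef s (<< p >> : free_hom k x y) = (val p == s)%:R.
Proof.
rewrite /path_coef; case: insubP => [q _ <-|] /=.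
  by rewrite mcoeffU -val_eqE.
by case: eqP => // <-; rewrite (valP p).
Qed.

(** The functor from the free category that is the identity on vertices and
    arrows; paths of length at least two go to 0. *)
Definition free_eval x y (f : free_hom k x y) : B :=
  [ffun z => match z with
   | inl v => if x == v then path_coef [::] f else 0
   | inr a => path_coef [:: a] f
   end].

Lemma free_eval_linear x y : linear (@free_eval x y).
Proof.
move=> c f g; apply/ffunP=> -[v|a]; rewrite !ffunE path_coefP //.
by case: ifP => // _; rewrite scaler0 addr0.
Qed.
HB.instance Definition _ x y :=
  GRing.isLinear.Build k (free_hom k x y) B _ (@free_eval x y)
    (@free_eval_linear x y).

Lemma free_evalP x y c (f g : free_hom k x y) :
  free_eval (c *: f + g) = c *: free_eval f + free_eval g.
Proof. exact: free_eval_linear. Qed.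

Lemma free_eval0 x y : free_eval (0 : free_hom k x y) = 0.
Proof. exact: linear0. Qed.

Lemma free_eval_nil x : free_eval (free_id k x) = ev x.
Proof.
apply/ffunP=> -[v|a]; rewrite !ffunE path_coefU //= (inj_eq inl_inj) eq_sym.
by case: (v == x).
Qed.

Lemma free_evalUU x y z (q : qpath y z) (p : qpath x y) :
  free_eval (<< path_comp q p >> : free_hom k x z) =
  free_eval (<< q >> : free_hom k y z) * free_eval (<< p >> : free_hom k x y).
Proof.
apply/ffunP=> -[v|a]; rewrite rszME !ffunE !path_coefU /=;
  case: p q => -[|b [|c p]] /= pP [q qP] /=; rewrite ?mulr0 ?mul0r ?addr0 //.
- move/eqP: pP qP => <- _; case: (x == v); last by rewrite mul0r.
  by rewrite mulr1.
- by rewrite if_same mulr0.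
- by rewrite if_same mulr0.
- rewrite add0r; move/eqP: pP => exy; rewrite -exy in qP *.
  case: eqP qP => [-> /= /andP[/eqP-> _]|]; last by rewrite mul0r.
  by rewrite eqxx mulr1.
- case/andP: pP => /eqP sx /eqP ty; rewrite if_same mulr0 addr0.
  rewrite !eqseq_cons; case: (eqVneq b a) => [<-|_]; last by rewrite mulr0.
  by rewrite -ty eqxx mulr1 .
- by rewrite !eqseq_cons !andbF mulr0 if_same mulr0 addr0.
Qed.

Lemma free_evalM x y z (g : free_hom k y z) (f : free_hom k x y) :
  free_eval (free_comp g f) = free_eval g * free_eval f.
Proof.
elim/free_hom_ind: g => [|c q g IHg].
  by rewrite [X in free_eval X]free_comp0l !free_eval0 mul0r.
transitivity (free_eval (c *: free_comp (<< q >> : free_hom k y z) f + free_comp g f)).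
  by apply: congr1; exact: free_comp_linl.
rewrite [LHS]free_evalP [X in _ = X * _]free_evalP mulrDl -scalerAl.
apply: (congr2 (fun u w => c *: u + w) _ IHg).
elim/free_hom_ind: f {IHg} => [|d p f IHf].
  by rewrite [X in free_eval X]free_comp0r !free_eval0 mulr0.
transitivity (free_eval (d *: free_comp (<< q >> : free_hom k y z)
    (<< p >> : free_hom k x y) + free_comp (<< q >> : free_hom k y z) f)).
  by apply: congr1; exact: free_comp_linr.
rewrite [LHS]free_evalP [X in _ = _ * X]free_evalP mulrDr -scalerAr.
apply: (congr2 (fun u w => d *: u + w) _ IHf).
by rewrite [X in free_eval X]free_compUU mulr1 free_evalUU.
Qed.

Lemma free_eval_rel (x y : lobj FC) (f g : lhom x y) :
  gen_rel R f g -> free_eval f = free_eval g.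
Proof.
elim=> {x y f g}.
- move=> x y f g []{x y f g} x y p sz; rewrite free_eval0.
  apply/ffunP=> -[v|a]; rewrite !ffunE path_coefU.
    by case: (val p) sz => //=; rewrite if_same.
  by case: (val p) sz => [//|b [//|c s]] _; rewrite eqseq_cons andbF.
- by [].
- by move=> x y f g _ ->.
- by move=> x y f g h _ -> _ ->.
- by move=> x y c f f' g g' _ ef _ eg; rewrite !free_evalP ef eg.
- move=> x y z g g' f f' _ eg _ ef.
  exact: etrans (free_evalM g f) (etrans (congr2 *%R eg ef) (esym (free_evalM g' f'))).
Qed.

Definition free_mono x y (s : seq (arrow Q)) : free_hom k x y :=
  oapp (fun p : {p : seq (arrow Q) | is_qpath x y p} =>
     << (p : qpath x y) >> : free_hom k x y) 0 (insub s).

Lemma free_monoE x y (p : qpath x y) : free_mono x y (val p) = << p >>.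
Proof.
rewrite /free_mono; case: insubP => [q _ /val_inj->//|/negP[]].
exact: (valP p).
Qed.

Definition free_lift x y (f : B) : free_hom k x y :=
  f (inl x) *: free_mono x y [::] + \sum_a f (inr a) *: free_mono x y [:: a].

Lemma rsz_comb_linear (V : lmodType k) x (m : V) (w : arrow Q -> V) :
  linear (fun f : B => f (inl x) *: m + \sum_a f (inr a) *: w a).
Proof.
move=> c f g /=; rewrite scalerDr addrACA scaler_sumr -big_split /=.
by rewrite rsz_coefP; congr (_ + _); apply: eq_bigr => a _; apply: rsz_coefP.
Qed.

Lemma free_lift_linear x y : linear (@free_lift x y).
Proof. exact: rsz_comb_linear. Qed.

(** A long path is the composition of its first two arrows and of the rest. *)
Lemma long_path_zero x y (p : qpath x y) :
  (2 <= size (val p))%N -> @gen_rel _ FC R x y (<< p >> : free_hom k x y) 0.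
Proof.
case: p => -[|a [|b s]] //= pP _.
have /and3P[/eqP sa /eqP sb tb] := pP.
have p2P : is_qpath x (target b) [:: a; b] by rewrite /= sa sb !eqxx.
pose p2 : qpath x (target b) := to_qpath p2P.
pose q : qpath (target b) y := to_qpath tb.
have := @gen_comp _ FC R _ _ _ _ _ _ _
  (@gen_refl _ FC R _ _ (<< q >> : free_hom k _ _))
  (@gen_base _ FC R _ _ _ _ (@ConsecutiveArrowsZero k Q _ _ p2 (erefl _))).
set g := lcomp _ _; set h := lcomp _ _ => gh.
have eg : g = << @to_qpath x y [:: a, b & s] pP >>.
  apply: etrans (free_compUU _ _ _ _) _; rewrite mulr1.
  by apply: (congr1 (fun p' => mkmalgU p' (1 : k))); apply: val_inj.
by move: gh; rewrite eg (_ : h = 0) //; apply: free_comp0r.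
Qed.

(** The relations generate the whole kernel of [free_eval], because every
    morphism is congruent to a combination of paths of length at most one,
    which its image determines. *)
Lemma free_lift_eval x y (f : free_hom k x y) :
  @gen_rel _ FC R x y f (free_lift x y (free_eval f)).
Proof.
elim/free_hom_ind: f => [|c p f IHf].
  rewrite free_eval0 /free_lift ffunE scale0r add0r big1 ?add0r => [|a _]; last first.
    by rewrite ffunE scale0r.
  exact: gen_refl.
rewrite free_evalP free_lift_linear; apply: gen_linear IHf.
have [sz|sz] := leqP 2 (size (val p)).
  rewrite (_ : free_lift _ _ _ = 0); first exact: long_path_zero.
  rewrite /free_lift ffunE eqxx path_coefU big1 => [|a _].
    by case: (val p) sz => //= b s; rewrite scale0r add0r.
  rewrite ffunE path_coefU; case: (val p) sz => [//|b [//|c' s]] _.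
  by rewrite eqseq_cons andbF scale0r.
rewrite (_ : free_lift _ _ _ = << p >>); first exact: gen_refl.
rewrite -[RHS]free_monoE /free_lift ffunE eqxx path_coefU.
case ep: (val p) sz => [|b [|//]] _.
  rewrite eqxx scale1r big1 ?addr0 // => a _.
  by rewrite ffunE path_coefU ep scale0r.
rewrite scale0r add0r (bigD1 b) //= ffunE path_coefU ep eqxx scale1r.
rewrite big1 ?addr0 // => a /negPf nab.
by rewrite ffunE path_coefU ep eqseq_cons eq_sym nab scale0r.
Qed.

Lemma free_eval_mono x y s : free_eval (free_mono x y s) =
  if is_qpath x y s then
    if s is [::] then ev x else if s is [:: a] then ar a else 0
  else 0.
Proof.
case: ifP => [sP|sF]; last by rewrite /free_mono insubF // linear0.
pose p : qpath x y := to_qpath sP.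
rewrite -[s]/(val p) free_monoE /=.
apply/ffunP=> -[v|a]; rewrite ffunE path_coefU /=.
  case: s {sP p} => [|b [|c s]]; rewrite !ffunE ?if_same //=.
  by rewrite (inj_eq inl_inj) eq_sym; case: (v == x).
case: s {sP p} => [|b [|c s]]; rewrite ?ffunE // eqseq_cons ?andbF ?andbT //.
by rewrite (inj_eq inr_inj) eq_sym.
Qed.

Lemma free_lift_corner x y (f : B) :
  free_eval (free_lift x y (ev y * f * ev x)) = ev y * f * ev x.
Proof.
rewrite [RHS]rsz_sum /free_lift raddfD /= linearZ /= raddf_sum /=.
congr (_ + _).
  rewrite free_eval_mono /= (bigD1 x) //= big1 ?addr0 => [|v /negPf nvx].
    by rewrite rsz_corner ffunE eqxx /=; case: eqP => // _; rewrite !scale0r.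
  by rewrite rsz_corner ffunE nvx scale0r.
apply: eq_bigr => a _; rewrite linearZ /= free_eval_mono /=.
by rewrite rsz_corner ffunE; case: ifP => // _; rewrite !scale0r.
Qed.

Lemma free_eval_corner x y (f : free_hom k x y) :
  free_eval f \in corner (fun v => ev v) x y.
Proof.
apply/cornerP; exists (free_eval f).
by rewrite -!free_eval_nil -!free_evalM free_comp1r free_comp1l.
Qed.

Definition presentation_map x y
    (q : lhom (l := quotient_cat (generated_congruence R)) x y) :
    subvs_of (corner (fun v => ev v) x y) :=
  Subvs (free_eval_corner (repr q)).

Lemma presentation_map_class x y (f : free_hom k x y) :
  presentation_map (qclass (generated_congruence R) f) = Subvs (free_eval_corner f).
Proof.
apply: val_inj; apply: free_eval_rel.
exact: (repr_lquot_pi (generated_congruence R x y) f).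
Qed.

Lemma presentation_map_linear x y : linear (@presentation_map x y).
Proof.
move=> c q q'; have [f ->] := qclass_surj q; have [f' ->] := qclass_surj q'.
rewrite -[c *: _ + _](linearP (lquot_pi (generated_congruence R x y))).
rewrite !presentation_map_class; apply: val_inj.
exact: linearP.
Qed.
HB.instance Definition _ x y := GRing.isLinear.Build k _ _ _
  (@presentation_map x y) (@presentation_map_linear x y).

Lemma rsz_is_presentation : is_presentation_of_split_basic B R.
Proof.
exists (fun v => ev v), (rsz_complete k v0); split; first exact: rsz_is_quiver.
exists id, (fun x y => @presentation_map x y : {linear _ -> _}); split.
- by exists id.
- move=> x y; exists (fun z => qclass (generated_congruence R)
      (free_lift x y (vsval z) : lhom (l := FC) x y)) => [q|z].
    have [f ->] := qclass_surj q.
    apply: etrans (congr1 (fun w => qclass (generated_congruence R)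
      (free_lift x y (vsval w) : lhom (l := FC) x y)) (presentation_map_class f)) _.
    by apply/lquot_piP; apply: gen_sym; apply: free_lift_eval.
  apply: etrans (presentation_map_class (free_lift x y (vsval z))) _.
  apply: val_inj; have /cornerP[a ea] := subvsP z.
  by rewrite /= ea free_lift_corner.
- move=> x; apply: etrans (presentation_map_class (free_id k x)) _.
  by apply: val_inj; apply: free_eval_nil.
- move=> x y z g f.
  have [g0 ->] := qclass_surj g; have [f0 ->] := qclass_surj f.
  rewrite [in RHS]/= !presentation_map_class.
  have qE := congr1 (@presentation_map _ _) (qcompE (generated_congruence R) g0 f0).
  apply: etrans qE _.
  apply: etrans (presentation_map_class (free_comp g0 f0)) _.
  by apply: val_inj; apply: free_evalM.
Qed.

End RadicalSquareZeroPresentation.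

(** * Orientations of monotone maps *)

Section Orientation.
Variable n : nat.
Implicit Types (g h : OD n) (S T : {set 'I_n}).

(** Constant maps have both orientations; they count as order-preserving. *)
Definition reversing g : bool := ~~ order_preserving g.

Lemma od_monotone g (x y : 'I_n) : (x <= y)%N ->
  if reversing g then (g y <= g x)%N else (g x <= g y)%N.
Proof.
rewrite /reversing; case: ifPn => [nOP|/negPn/(monoP _ leq)/(_ x y)//].
have := od_funP g; rewrite (negPf nOP) => /(monoP _ geq)/(_ x y).
exact.
Qed.

Lemma reversingE g (x y : 'I_n) : (x <= y)%N -> g x != g y ->
  reversing g = (g y < g x)%N.
Proof.
move=> xy; rewrite -val_eqE /= neq_ltn; have := od_monotone g xy.
by case: reversing; case: ltngtP.
Qed.

(** Orientations multiply as soon as the composite is not constant. *)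
Lemma reversingM g h (x y : 'I_n) : (g * h)%g x != (g * h)%g y ->
  reversing (g * h)%g = reversing g (+) reversing h.
Proof.
wlog xy : x y / (x <= y)%N => [wl|neq].
  by have [/wl//|/ltnW/wl] := leqP x y; rewrite eq_sym.
have ghE z : (g * h)%g z = g (h z) by rewrite ffunE.
have nh : h x != h y by apply: contra neq => /eqP e; rewrite !ghE e.
rewrite (reversingE xy neq) (reversingE xy nh) !ghE; rewrite !ghE in neq.
have [hxy|hxy] := ltnP (h y) (h x).
  rewrite eq_sym in neq; rewrite (reversingE (ltnW hxy) neq) addbT.
  by move: neq; rewrite -val_eqE /=; case: ltngtP.
by rewrite (reversingE hxy neq) addbF.
Qed.

End Orientation.

(** * Normalized chains of the simplex *)

Section Chains.
Variables (k : fieldType) (n : nat).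
Implicit Types (g h : OD n) (S T : {set 'I_n}).

(** A face of the simplex together with the name of the copy of the chain
    complex that it belongs to: [true] is the copy twisted by orientations. *)
Definition cell := (bool * {set 'I_n})%type.
Implicit Types p q : cell.
Definition chains := {ffun cell -> k^o}.
HB.instance Definition _ := Vector.on chains.

Definition cell_chain p : chains := [ffun q => (q == p)%:R].

Definition extend (F : cell -> chains) (v : chains) : chains :=
  \sum_p v p *: F p.

Lemma extend_linear F : linear (extend F).
Proof.
move=> c v w; rewrite /extend scaler_sumr -big_split; apply: eq_bigr => p _.
by rewrite !ffunE scalerDl scalerA.
Qed.
HB.instance Definition _ F :=
  GRing.isLinear.Build k chains chains _ (extend F) (extend_linear F).

Lemma extend_cell F p : extend F (cell_chain p) = F p.
Proof.
rewrite /extend (bigD1 p) //= ffunE eqxx scale1r big1 ?addr0 // => q npq.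
by rewrite ffunE (negPf npq) scale0r.
Qed.

Lemma extend_comp F G v : extend F (extend G v) = extend (fun p => extend F (G p)) v.
Proof. by rewrite {2}/extend linear_sum; apply: eq_bigr => p _; rewrite linearZ. Qed.

Lemma eq_extend F G v : F =1 G -> extend F v = extend G v.
Proof. by move=> FG; apply: eq_bigr => p _; rewrite FG. Qed.

(** The twisted copy starts in size two, as constant maps have no
    orientation. *)
Definition min_size (s : bool) : nat := if s then 2 else 1.
(** The generators that are left out by the truncation are set to 0; with this
    convention the formulas for the action and for the boundary need no case
    distinction at the bottom of the complexes. *)
Definition simplex p : chains :=
  if (min_size p.1 <= #|p.2|)%N then cell_chain p else 0.

Definition below S (x : 'I_n) := [set y in S | (y < x)%N].
Definition bdry_cell p : chains :=
  \sum_(x in p.2) (-1) ^+ #|below p.2 x| *: simplex (p.1, p.2 :\ x).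
Definition bdry := extend bdry_cell.

(** The binomial coefficient is the number of inversions of the permutation
    that reverses l points. *)
Definition od_sign (s : bool) (l : nat) g : k :=
  (-1) ^+ (reversing g * ('C(l, 2) + s)).
Definition od_cell g p : chains :=
  if #|g @: p.2| == #|p.2| then od_sign p.1 #|p.2| g *: simplex (p.1, g @: p.2) else 0.
Definition od_act g := extend (od_cell g).

HB.instance Definition _ := GRing.Linear.on bdry.
HB.instance Definition _ g := GRing.Linear.on (od_act g).

Lemma extend_simplex F p : (min_size p.1 <= #|p.2|)%N -> extend F (simplex p) = F p.
Proof. by rewrite /simplex => ->; rewrite extend_cell. Qed.

Lemma od_act_simplex g p : od_act g (simplex p) = od_cell g p.
Proof.
case: (boolP (min_size p.1 <= #|p.2|)%N) => [|np]; first exact: extend_simplex.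
rewrite /od_cell /simplex (negPf np) linear0 /=; case: eqP => // ->.
by rewrite (negPf np) scaler0.
Qed.

Lemma bdry_simplex p : bdry (simplex p) = bdry_cell p.
Proof.
case: (boolP (min_size p.1 <= #|p.2|)%N) => [|np]; first exact: extend_simplex.
rewrite /bdry_cell /simplex (negPf np) linear0 big1 // => x xp /=.
suff /negPf -> : ~~ (min_size p.1 <= #|p.2 :\ x|)%N by rewrite scaler0.
by apply: contra np => /leq_trans -> //; apply/subset_leq_card/subsetDl.
Qed.

(** Where [g * h] does not kill a face S it is injective on S. So if S has two
    points it is not constant and orientations multiply, while on a single
    point all the signs are 1. *)
Lemma od_actM g h v : od_act (g * h)%g v = od_act g (od_act h v).
Proof.
rewrite /od_act extend_comp; apply: eq_extend => -[s S].
rewrite -/(od_act g) /od_cell /=.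
have ghE : (g * h)%g @: S = g @: (h @: S).
  by rewrite -imset_comp; apply: eq_imset => x; rewrite /= ffunE.
rewrite ghE; case: (#|h @: S| =P #|S|) => [hS|nhS]; last first.
  rewrite linear0; case: eqP => // e; case: nhS; apply/eqP.
  by rewrite eqn_leq leq_imset_card -e leq_imset_card.
rewrite linearZ /= od_act_simplex /od_cell /= hS.
case: eqP => [gS|]; last by rewrite scaler0.
rewrite scalerA /simplex /= gS; case: ifP => [sz|]; last by rewrite !scaler0.
congr (_ *: _); rewrite /od_sign -exprD.
have [big|small] := leqP 2 #|S|; last first.
  suff -> : (nat_of_bool s = 0)%N by rewrite bin_small // !(muln0, mul0n).
  by case: s sz => // /leq_ltn_trans /(_ small).
have /card_gt1P[x [y [xS yS nxy]]] : (1 < #|S|)%N by [].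
have inj : {in S &, injective (g * h)%g} by apply/imset_injP; rewrite ghE gS.
rewrite (@reversingM _ g h x y); last by apply: contra nxy => /eqP/inj ->.
case: (reversing g); case: (reversing h); rewrite /= ?mul0n ?mul1n ?addn0 //.
by rewrite addnn -[RHS]signr_odd odd_double.
Qed.

Lemma od_act1 v : od_act 1%g (simplex v) = simplex v.
Proof.
rewrite od_act_simplex /od_cell.
have -> : (1%g : OD n) @: v.2 = v.2.
  by rewrite -[RHS]imset_id; apply: eq_imset => x; rewrite ffunE.
rewrite eqxx /od_sign (_ : reversing _ = false) ?mul0n ?scale1r -?surjective_pairing //.
apply/negbTE/negPn/(monoP _ leq) => x y; by rewrite !ffunE.
Qed.

Lemma card_below_del S (x y : 'I_n) : x \in S ->
  #|below S y| = ((x < y) + #|below (S :\ x) y|)%N.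
Proof.
move=> xS; rewrite (cardsD1 x) inE xS; congr (_ + _)%N.
by apply: eq_card => z; rewrite !inE andbA.
Qed.

(** Removing first x and then y, and first y and then x, occur with opposite
    signs. *)
Lemma bdry_bdry v : bdry (bdry v) = 0.
Proof.
rewrite /bdry extend_comp (eq_extend (G := fun=> 0)); last first.
  move=> [s S]; rewrite -/bdry /bdry_cell linear_sum /=.
  under eq_bigr => x xS do rewrite linearZ /= bdry_simplex /bdry_cell /= scaler_sumr.
  pose F x y := (-1) ^+ #|below S x| *: ((-1) ^+ #|below (S :\ x) y| *:
    simplex (s, S :\ x :\ y)).
  transitivity (\sum_(x in S) \sum_(y in S | (y < x)%N) F x y +
                \sum_(x in S) \sum_(y in S | (x < y)%N) F x y).
    rewrite -big_split; apply: eq_bigr => x xS /=.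
    rewrite (bigID (fun y : 'I_n => (y < x)%N)) /=.
    congr (_ + _); apply: eq_bigl => y; rewrite !inE -val_eqE /=;
      case: (y \in S); rewrite ?andbF //=; by case: ltngtP.
  rewrite [X in _ + X](_ : _ = \sum_(x in S) \sum_(y in S | (y < x)%N) F y x).
    2: rewrite (exchange_big_dep (mem S)) /=; last by move=> x y _ /andP[].
    2: by apply: eq_bigr => x xS; apply: eq_bigl => y; rewrite xS.
  rewrite -big_split big1 // => x xS; rewrite -big_split big1 // => y /andP[yS yx].
  rewrite /F /= (card_below_del x yS) yx (card_below_del y xS) ltnNge (ltnW yx) /=.
  rewrite setDDl setDDl [[set y] :|: _]setUC !scalerA -scalerDl add0n add1n.
  by rewrite exprS mulN1r mulNr [X in - X + _]mulrC addNr scale0r.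
by rewrite /extend big1 // => p _; rewrite scaler0.
Qed.

Lemma od_ltn_inj g S : {in S &, injective g} -> {in S &, forall x y,
  (g y < g x)%N = if reversing g then (x < y)%N else (y < x)%N}.
Proof.
move=> inj x y xS yS; case: (ltngtP x y) => [xy|yx|/val_inj->]; last first.
- by rewrite ltnn if_same.
- have := od_monotone g (ltnW yx); have : g y != g x.
    by apply: contraTneq yx => /inj->//; rewrite ltnn.
  by rewrite -val_eqE /=; case: reversing; case: ltngtP.
have := od_monotone g (ltnW xy); have : g y != g x.
  by apply: contraTneq xy => /inj->//; rewrite ltnn.
by rewrite -val_eqE /=; case: reversing; case: ltngtP.
Qed.

(** An order-reversing map turns the points of S below x into the points of
    g(S) above g(x). *)
Lemma card_below_imset g S (x : 'I_n) : {in S &, injective g} -> x \in S ->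
  if reversing g then (#|below (g @: S) (g x)| + #|below S x|).+1 = #|S|
  else #|below (g @: S) (g x)| = #|below S x|.
Proof.
move=> inj xS.
have -> : #|below (g @: S) (g x)| =
    #|[set y in S | if reversing g then (x < y)%N else (y < x)%N]|.
  have sub : {in [set y in S | if reversing g then (x < y)%N else (y < x)%N] &,
      injective g}.
    by apply: sub_in2 inj => y; rewrite inE => /andP[].
  rewrite -(card_in_imset sub); apply: eq_card => z; rewrite !inE.
  apply/andP/imsetP=> [[/imsetP[y yS ->] lt]|[y]].
    by exists y => //; rewrite inE yS -(od_ltn_inj inj).
  by rewrite inE => /andP[yS lt ->]; rewrite imset_f // (od_ltn_inj inj).
case: reversing => //.
rewrite [RHS](cardsD1 x) xS add1n; congr _.+1.
rewrite -[RHS](cardsID [set y : 'I_n | (x < y)%N]); congr (_ + _)%N;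
  apply: eq_card => y;
  rewrite !inE -?val_eqE /=; case: (y \in S); rewrite ?andbF //=; by case: ltngtP.
Qed.

(** If g is injective on S the faces of S correspond to those of g(S), and only
    signs have to be compared. Otherwise g identifies two points a < b of S; by
    monotonicity a face of S on which g is injective can exist only if a and b
    are consecutive, and then the faces opposite to a and b have the same image
    and opposite signs. *)
Lemma od_act_bdry g v : od_act g (bdry v) = bdry (od_act g v).
Proof.
rewrite /od_act /bdry !extend_comp; apply: eq_extend => -[s S].
rewrite -/(od_act g) -/bdry /bdry_cell linear_sum /=.
under eq_bigr => x xS do rewrite linearZ /= od_act_simplex.
rewrite {2}/od_cell /=; case: eqP => [gS|ngS]; last first.
  rewrite linear0.
  have /exists_inP[a aS /exists_inP[b bS /andP[ab /eqP gab]]] :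
      [exists a in S, exists b in S, (a < b)%N && (g a == g b)].
    apply: contraT => no; case: ngS; apply/eqP/imset_injP => x y xS yS gxy.
    apply/eqP; apply: contraR no; rewrite -val_eqE /= neq_ltn => /orP[xy|yx].
      apply/exists_inP; exists x => //; apply/exists_inP.
      by exists y; rewrite ?xy ?gxy ?eqxx.
    apply/exists_inP; exists y => //; apply/exists_inP.
    by exists x; rewrite ?yx ?gxy ?eqxx.
  (* A face that contains both a and b is killed. *)
  have nba : b != a by rewrite -val_eqE /= gtn_eqF.
  rewrite (bigD1 a) //= (bigD1 b) /=; last by rewrite bS nba.
  rewrite big1 ?addr0 => [|x /andP[/andP[xS xa] xb]]; last first.
    rewrite /od_cell /=; case: eqP => [/eqP/imset_injP inj|]; last by rewrite scaler0.
    by case/eqP: nba; apply: esym; apply: inj => //; rewrite !inE eq_sym ?(xa, xb).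
  have eqim : g @: (S :\ a) = g @: (S :\ b).
    have sub c d : c \in S -> d \in S -> c != d -> g c = g d ->
        g @: (S :\ c) \subset g @: (S :\ d).
      move=> cS dS ncd gcd; apply/subsetP=> _ /imsetP[y yS ->].
      have [->|nyd] := eqVneq y d; first by rewrite -gcd imset_f // !inE ncd.
      by move: yS; rewrite !inE => /andP[_ yS]; rewrite imset_f // !inE nyd.
    by apply/eqP; rewrite eqEsubset !sub // eq_sym.
  have eqc : #|S :\ a| = #|S :\ b|.
    by have := cardsD1 a S; rewrite (cardsD1 b S) aS bS => /addnI.
  rewrite {1}/od_cell /= eqim eqc -/(od_cell g (s, S :\ b)) -scalerDl.
  rewrite /od_cell /=; case: eqP => [/eqP/imset_injP inj|]; last by rewrite scaler0.
  rewrite (card_below_del b aS) ab.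
  (* No point of S lies strictly between a and b. *)
  suff -> : below (S :\ a) b = below S a by rewrite exprS mulN1r addrN scale0r.
  apply/setP=> y; rewrite !inE; case yS: (y \in S); rewrite ?andbF //= andbT.
  apply/andP/idP => [[ya yb]|ya]; last first.
    by rewrite -val_eqE /= ltn_eqF // (ltn_trans ya ab).
  rewrite ltnNge; apply/negP => ay; have nyb : y != b by rewrite -val_eqE /= ltn_eqF.
  have gya : g y = g a.
    apply: val_inj; apply/eqP; rewrite eqn_leq.
    have := od_monotone g ay; have := od_monotone g (ltnW yb).
    by rewrite -gab; case: reversing => -> ->.
  case/eqP: ya; apply: inj => //; rewrite !inE ?yS ?nyb //.
  by rewrite aS eq_sym nba.
have inj : {in S &, injective g} by apply/imset_injP/eqP.
rewrite linearZ /= bdry_simplex /bdry_cell /= (big_imset _ inj) scaler_sumr.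
apply: eq_bigr => x xS /=.
have gSx : g @: (S :\ x) = g @: S :\ g x.
  apply/setP=> z; rewrite !inE; apply/imsetP/andP=> [[y]|[zx /imsetP[y yS ezy]]].
    rewrite !inE => /andP[yx yS] ->; rewrite imset_f //; split=> //.
    by apply: contra yx => /eqP/inj->.
  by exists y => //; rewrite !inE yS andbT; apply: contra zx => /eqP <-; rewrite ezy.
(* From size l.+1 to size l the reversing sign changes by (-1)^l, which is also
   the ratio of the signs attached to x in S and to g x in g(S). *)
have cS : #|S| = #|S :\ x|.+1 by rewrite (cardsD1 x) xS.
rewrite /od_cell /= gSx; have -> : #|g @: S :\ g x| = #|S :\ x|.
  by apply/eqP; rewrite -eqSS -cS -gS [in X in _ == X](cardsD1 (g x)) imset_f.
rewrite eqxx !scalerA; congr (_ *: _); rewrite /od_sign -!exprD.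
have := card_below_imset inj xS; rewrite cS.
case: reversing => [[e]|->]; last by rewrite !mul0n addn0.
set c := 'C(_, 2); rewrite !mul1n binS bin1 -/c -e.
set a := #|below S x|; set b := #|below _ _|.
rewrite (_ : c + (b + a) + s + b = a + (c + s) + b * 2)%N; last by lia.
by rewrite [RHS]exprD exprM sqrr_sign mulr1.
Qed.

End Chains.

(** * The action of the monoid algebra *)

Lemma linear_comb (k : fieldType) (V W : lmodType k) (f : {linear V -> W})
    (J : finType) (P : pred J) (c : J -> k) (F : J -> V) :
  f (\sum_(j | P j) c j *: F j) = \sum_(j | P j) c j *: f (F j).
Proof. by rewrite linear_sum; apply: eq_bigr => j _; rewrite linearZ. Qed.

Section AlgebraAction.
Variables (k : fieldType) (n : nat).
Local Notation A := (OD_algebra k n).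
Implicit Types (a b : A) (g h : OD n) (S T : {set 'I_n}) (p q : cell n).
Implicit Types (u v : chains k n).

Definition alg_act a v : chains k n := \sum_g a g *: od_act g v.

Lemma alg_act_linear a : linear (alg_act a).
Proof.
move=> c u v; rewrite /alg_act scaler_sumr -big_split; apply: eq_bigr => g _ /=.
by rewrite linearP scalerDr !scalerA mulrC.
Qed.
HB.instance Definition _ a :=
  GRing.isLinear.Build k (chains k n) (chains k n) _ (alg_act a)
    (alg_act_linear a).

Lemma alg_actDl c a b v : alg_act (c *: a + b) v = c *: alg_act a v + alg_act b v.
Proof.
rewrite /alg_act scaler_sumr -big_split; apply: eq_bigr => g _ /=.
by rewrite !ffunE scalerDl scalerA.
Qed.

Lemma alg_act0l v : alg_act 0 v = 0.
Proof. by rewrite /alg_act big1 // => g _; rewrite ffunE scale0r. Qed.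

Lemma alg_act_suml (J : finType) (c : J -> k) (F : J -> A) v :
  alg_act (\sum_j c j *: F j) v = \sum_j c j *: alg_act (F j) v.
Proof.
apply: (big_rec2 (fun a w => alg_act a v = w)); first exact: alg_act0l.
by move=> j w a _ <-; rewrite alg_actDl.
Qed.

Lemma alg_actM a b v : alg_act (a * b) v = alg_act a (alg_act b v).
Proof.
rewrite {1}/alg_act.
transitivity (\sum_(g : OD n) \sum_(h : OD n) (a g * b h) *: od_act (g * h)%g v).
  have mulE z : (a * b) z = \sum_(g : OD n) \sum_(h : OD n | (g * h)%g == z) a g * b h.
    by rewrite ffunE.
  transitivity (\sum_(z : OD n) \sum_(g : OD n) \sum_(h : OD n | (g * h)%g == z)
      (a g * b h) *: od_act (k := k) (g * h)%g v).
    apply: eq_bigr => z _; rewrite mulE scaler_suml; apply: eq_bigr => g _.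
    by rewrite scaler_suml; apply: eq_bigr => h /eqP->.
  rewrite exchange_big; apply: eq_bigr => g _ /=.
  rewrite (exchange_big_dep xpredT) //=; apply: eq_bigr => h _.
  by rewrite (big_pred1 (g * h)%g) // => z; rewrite eq_sym.
apply: eq_bigr => g _.
transitivity (a g *: \sum_(h : OD n) b h *: od_act g (od_act h v)).
  rewrite scaler_sumr; apply: eq_bigr => h _.
  by rewrite od_actM scalerA.
apply: congr1; apply: esym.
exact: (linear_comb (od_act g)).
Qed.

Lemma alg_act1 p : alg_act 1 (simplex k p) = simplex k p.
Proof.
rewrite /alg_act (bigD1 (1%g : OD n)) //= ffunE eqxx scale1r od_act1.
by rewrite big1 ?addr0 // => g /negPf ng; rewrite ffunE ng scale0r.
Qed.

Lemma alg_act_bdry a v : alg_act a (bdry v) = bdry (alg_act a v).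
Proof.
rewrite [RHS](linear_comb (@bdry k n)).
by apply: eq_bigr => g _; rewrite od_act_bdry.
Qed.

(** ** Degrees *)

(** Degrees are indexed by the copy of the complex and by the size of faces;
    chains must also vanish on the truncated generators. *)
Definition homog (s : bool) (l : nat) v : Prop :=
  forall q, ~~ [&& q.1 == s, #|q.2| == l & (min_size s <= l)%N] -> v q = 0.

Lemma homogP s l c u v : homog s l u -> homog s l v -> homog s l (c *: u + v).
Proof. by move=> hu hv q hq; rewrite !ffunE hu // hv // scaler0 addr0. Qed.

Lemma homog0 s l : homog s l 0.
Proof. by move=> q _; rewrite ffunE. Qed.

Lemma homogZ s l c v : homog s l v -> homog s l (c *: v).
Proof. by move=> hv; rewrite -[_ *: _]addr0; apply: homogP => //; apply: homog0. Qed.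

Lemma homog_sum (J : finType) (P : pred J) s l (c : J -> k) (F : J -> chains k n) :
  (forall j, P j -> homog s l (F j)) -> homog s l (\sum_(j | P j) c j *: F j).
Proof.
move=> hF; apply: (big_rec (homog s l)) => [|j w Pj hw]; first exact: homog0.
by apply: homogP => //; apply: hF.
Qed.

Lemma homog_simplex s S : homog s #|S| (simplex k (s, S)).
Proof.
move=> [s' T]; rewrite /simplex; case: ifP => /= [sz nh|_ _]; rewrite ffunE //.
by case: ((s', T) =P (s, S)) nh => // -[-> ->]; rewrite !eqxx.
Qed.

Lemma homog_bdry_simplex s S : homog s #|S|.-1 (bdry (simplex k (s, S))).
Proof.
rewrite bdry_simplex; apply: homog_sum => x /= xS.
by have -> : #|S|.-1 = #|S :\ x| by [rewrite (cardsD1 x) xS]; apply: homog_simplex.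
Qed.

Lemma homog_alg_act a s S : homog s #|S| (alg_act a (simplex k (s, S))).
Proof.
apply: homog_sum => g _; rewrite od_act_simplex /od_cell /=; case: eqP => [<-|_].
  exact/homogZ/homog_simplex.
exact: homog0.
Qed.

Lemma alg_act_coef a s S T : #|T| = #|S| -> (min_size s <= #|S|)%N ->
  alg_act a (simplex k (s, S)) (s, T) =
  \sum_(g : OD n | g @: S == T) a g * od_sign k s #|S| g.
Proof.
move=> TS sz; rewrite sum_ffunE [RHS]big_mkcond; apply: eq_bigr => g _.
rewrite ffunE od_act_simplex /od_cell /=; case: (eqVneq (g @: S) T) => [->|ngT].
  by rewrite TS eqxx !ffunE /simplex /= TS sz ffunE eqxx; congr (_ * _); apply: mulr1.
case: ifP => [/eqP gS|_]; last by rewrite ffunE scaler0.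
rewrite ffunE /simplex /= gS sz ffunE xpair_eqE eqxx /= eq_sym (negPf ngT).
by rewrite !scaler0.
Qed.

Lemma homog_sumE s l v : homog s l v -> (min_size s <= l)%N ->
  v = \sum_(T : {set 'I_n} | #|T| == l) v (s, T) *: simplex k (s, T).
Proof.
move=> hv sz; apply/ffunP=> -[s' T]; rewrite sum_ffunE.
have [/andP[/eqP-> /eqP Tl]|nh] := boolP ((s' == s) && (#|T| == l)).
  rewrite (bigD1 T) ?Tl //= ffunE /simplex /= Tl sz ffunE eqxx [_ *: _]mulr1.
  rewrite big1 ?addr0 // => T' /andP[/eqP T'l nT]; rewrite T'l sz !ffunE.
  by rewrite xpair_eqE eq_sym (negPf nT) andbF scaler0.
rewrite hv /=; last by rewrite sz andbT.
rewrite big1 // => T' /eqP T'l; rewrite ffunE /simplex /= T'l sz ffunE xpair_eqE.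
case: (s' == s) nh => /= [nT|_]; last by rewrite scaler0.
case: (T =P T') nT => [->|_ _]; last by rewrite scaler0.
by rewrite T'l eqxx.
Qed.

End AlgebraAction.

(** * Faithfulness of the action *)

Section Faithfulness.
Variables (k : fieldType) (n : nat).
Local Notation A := (OD_algebra k n.+1).
Implicit Types (a b : A) (g h f : OD n.+1) (S T : {set 'I_n.+1}) (p q : cell n.+1).
Implicit Types (u v : chains k n.+1).

Definition fibre_mins f :=
  [set x : 'I_n.+1 | [forall y : 'I_n.+1, (y < x)%N ==> (f y != f x)]].

Lemma ord0_fibre_mins f : ord0 \in fibre_mins f.
Proof. by rewrite inE; apply/forallP => y; rewrite ltn0. Qed.

Lemma fibre_mins_inj f : {in fibre_mins f &, injective f}.
Proof.
move=> x y; rewrite !inE => /forallP/(_ y) xR /forallP/(_ x) yR fxy.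
by move: xR yR; rewrite fxy eqxx !implybF; case: ltngtP => // /val_inj.
Qed.

Lemma fibre_minsP f (x : 'I_n.+1) :
  exists s, [/\ s \in fibre_mins f, (s <= x)%N & f s = f x].
Proof.
case: (@arg_minnP _ x (fun y => f y == f x) val) => //= s /eqP fs smin.
exists s; split=> //; last exact: smin.
rewrite inE; apply/forallP=> y; apply/implyP=> ys; rewrite fs.
by apply: contraL ys => /smin; rewrite -leqNgt.
Qed.

Lemma card_below_inj T : {in T &, injective (fun x => #|below T x|)}.
Proof.
have lt (x y : 'I_n.+1) : x \in T -> (x < y)%N -> (#|below T x| < #|below T y|)%N.
  move=> xT xy; rewrite (cardsD1 x (below T y)) inE xT xy ltnS.
  apply/subset_leq_card/subsetP=> z; rewrite !inE => /andP[-> zx].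
  by rewrite (ltn_trans zx xy) -val_eqE /= ltn_eqF.
move=> x y xT yT /= e; case: (ltngtP x y) => [/lt|/lt|/val_inj//].
- by move=> /(_ xT); rewrite e ltnn.
- by move=> /(_ yT); rewrite e ltnn.
Qed.

(** On S a monotone map is determined by its image: the number of points of S
    below x gives the position of g(x) in g(S). *)
Lemma od_eq_on g f S : reversing g = reversing f ->
  {in S &, injective g} -> {in S &, injective f} -> g @: S = f @: S ->
  {in S, g =1 f}.
Proof.
move=> gf ginj finj gfS x xS.
have := card_below_imset ginj xS; have := card_below_imset finj xS.
rewrite -gf => fx gx; apply: (@card_below_inj (g @: S)); rewrite ?imset_f //.
  by rewrite gfS imset_f.
rewrite {2}gfS; case: reversing fx gx => [fx|-> ->//].
by rewrite -fx => -[/addIn].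
Qed.

(** A measure of maps that increases in the direction in which [height_lt]
    moves: upwards for order-preserving maps, downwards for reversing ones. *)
Definition height f : nat :=
  \sum_(x : 'I_n.+1) if reversing f then n - f x else f x.

(** The map g agrees with f on the least elements s of the fibres of f, and if
    s <= x is in the fibre of x then g(x) is beyond g(s) = f(s) = f(x). *)
Lemma height_lt g f : reversing g = reversing f ->
  g @: fibre_mins f = f @: fibre_mins f ->
  g != f -> (height f < height g)%N.
Proof.
move=> gf gfS ngf.
have ginj : {in fibre_mins f &, injective g}.
  apply/imset_injP; rewrite gfS; apply/imset_injP; exact: fibre_mins_inj.
have eq_gf := od_eq_on gf ginj (@fibre_mins_inj f) gfS.
have le x : ((if reversing f then n - f x else f x) <=
    (if reversing g then n - g x else g x) ?= iff (g x == f x))%N.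
  have [s [sR sx fs]] := fibre_minsP f x.
  have := od_monotone g sx; rewrite (eq_gf s sR) fs gf.
  have := ltn_ord (g x); have := ltn_ord (f x).
  rewrite -val_eqE /=; case: reversing => ? ? ?; apply/leqifP; case: eqP; lia.
have := leqif_sum (fun x (_ : xpredT x) => le x); rewrite /height => -[hle heq].
rewrite ltn_neqAle hle heq andbT; apply: contra ngf => /forallP eqgf.
by apply/eqP/val_inj/ffunP=> x; apply/eqP; have := eqgf x.
Qed.

Hypothesis char_k : 2%N \notin [pchar k].

(** For S with two points or more, the sum and the difference of the conditions
    on the two copies isolate the maps with a given orientation [r]; this uses
    that 2 is invertible. Among the nonconstant maps in the support of [a] with
    the same orientation, one of maximal height is then alone in the condition
    for S the set of its least fibre elements. Constant maps come last, with S
    the point 0. *)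
Lemma od_faithful a :
  (forall p, ord0 \in p.2 -> (min_size p.1 <= #|p.2|)%N ->
    alg_act a (simplex k p) = 0) -> a = 0.
Proof.
move=> a0.
have two : (2%:R : k) != 0 by move: char_k; rewrite inE.
have sum0 s S T : ord0 \in S -> #|T| = #|S| -> (min_size s <= #|S|)%N ->
    \sum_(g : OD n.+1 | g @: S == T) a g * od_sign k s #|S| g = 0.
  by move=> S0 TS sz; rewrite -alg_act_coef // a0 // ffunE.
have sum0r r S T : ord0 \in S -> #|T| = #|S| -> (2 <= #|S|)%N ->
    \sum_(g : OD n.+1 | (g @: S == T) && (reversing g == r)) a g = 0.
  move=> S0 TS sz.
  pose F r' : k := \sum_(g : OD n.+1 | (g @: S == T) && (reversing g == r')) a g.
  have e (s : bool) : F false + (-1) ^+ ('C(#|S|, 2) + s) * F true = 0.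
    rewrite -(sum0 s S T S0 TS); last by case: s => //=; apply: ltnW.
    rewrite (bigID (fun g => reversing g)) /= addrC; congr (_ + _).
      rewrite /F; apply: eq_big => [g|g /andP[_ /eqP rg]]; first by rewrite eqbF_neg.
      by rewrite /od_sign rg mul0n mulr1.
    rewrite mulr_sumr; apply: eq_big => [g|g /andP[_ /eqP rg]].
      by rewrite eqb_id.
    by rewrite /od_sign rg mul1n mulrC.
  have F0 : F false = 0.
    have := e true; rewrite addn1 exprS mulN1r mulNr => /subr0_eq eF.
    have := e false; rewrite addn0 -eF -mulr2n -mulr_natl => /eqP.
    by rewrite mulf_eq0 (negPf two) => /eqP.
  have F1 : F true = 0.
    by have /eqP := e false; rewrite F0 add0r mulf_eq0 signr_eq0 => /eqP.
  by case: r.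
have big0 f : (2 <= #|fibre_mins f|)%N -> a f = 0.
  move=> f2; apply/eqP; apply: contraT => af.
  pose ok g := [&& (2 <= #|fibre_mins g|)%N, a g != 0 & reversing g == reversing f].
  have okf : ok f by rewrite /ok f2 af eqxx.
  case: (arg_maxnP height okf) => f' /and3P[f'2 af' /eqP rf'] fmax.
  have := sum0r (reversing f) (fibre_mins f') (f' @: fibre_mins f') (ord0_fibre_mins f').
  rewrite (card_in_imset (@fibre_mins_inj f')) => /(_ erefl f'2).
  rewrite (bigD1 f') ?rf' ?eqxx //= big1 ?addr0 => [/eqP|g].
    by rewrite (negPf af').
  case/andP=> /andP[/eqP gS /eqP rg] ngf; apply/eqP; apply: contraT => ag.
  have hlt : (height f' < height g)%N by apply: height_lt; rewrite ?rg ?rf'.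
  suff /fmax le : ok g by have := leq_trans hlt le; rewrite ltnn.
  rewrite /ok ag rg eqxx !andbT.
  have -> : #|fibre_mins g| = #|g @: setT|.
    rewrite -(card_in_imset (@fibre_mins_inj g)); apply: eq_card => z.
    apply/imsetP/imsetP=> -[x _ ->]; first by exists x.
    by have [s [sR _ <-]] := fibre_minsP g x; exists s.
  apply: leq_trans (subset_leq_card (imsetS g (subsetT (fibre_mins f')))).
  by rewrite gS (card_in_imset (@fibre_mins_inj f')).
have const g : (#|fibre_mins g| < 2)%N -> forall x, g x = g ord0.
  move=> g1 x; have [s [sR _ <-]] := fibre_minsP g x; congr (g _).
  by apply/eqP; apply: contraTT g1 => ns; rewrite -leqNgt; apply/card_gt1P;
    exists s, ord0; rewrite ord0_fibre_mins.
apply/ffunP=> f; rewrite ffunE; case: (leqP 2 #|fibre_mins f|) => [/big0//|f1].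
have := sum0 false [set ord0] [set f ord0]; rewrite !cards1 inE eqxx.
move=> /(_ erefl erefl erefl); rewrite (bigD1 f) /= ?imset_set1 //.
rewrite /od_sign muln0 mulr1 big1 ?addr0 // => g; rewrite imset_set1.
case/andP=> /eqP/set1_inj gf ngf; case: (leqP 2 #|fibre_mins g|) => [/big0->|g1].
  by rewrite mul0r.
case/eqP: ngf; apply/val_inj/ffunP=> x.
by rewrite -[LHS]/(g x) -[RHS]/(f x) (const g g1) (const f f1).
Qed.

End Faithfulness.

(** * As many matrix entries as monoid elements *)

Section Existence.
Variable n : nat.
Implicit Types (f g : OD n.+1) (S T : {set 'I_n.+1}).

Lemma enum_set_sorted T : sorted ltn (map val (enum T)).
Proof.
have /subseq_sorted : subseq (map val (enum T)) (map val (enum 'I_n.+1)).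
  by apply: map_subseq; rewrite {1}/enum_mem -enumT filter_subseq.
by apply; [exact: ltn_trans|rewrite val_enum_ord iota_ltn_sorted].
Qed.

Lemma enum_set_lt T i j : (i < j < #|T|)%N ->
  (nth ord0 (enum T) i < nth ord0 (enum T) j)%N.
Proof.
rewrite cardE => /andP[ij jT].
have := @sorted_ltn_nth _ ltn ltn_trans 0%N _ (enum_set_sorted T) i j.
rewrite !inE !size_map => /(_ (ltn_trans ij jT) jT ij).
by rewrite !(nth_map ord0) // (ltn_trans ij jT).
Qed.

Section Preserving.
Variables (S T : {set 'I_n.+1}).
Hypotheses (S0 : ord0 \in S) (TS : #|T| = #|S|).

(** For x in S this is the position of x in S, counted from 1; the map
    constructed below jumps exactly at the points of S. *)
Definition upto (x : 'I_n.+1) := #|[set y in S | (y <= x)%N]|.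

Lemma upto_gt0 x : (0 < upto x)%N.
Proof. by apply/card_gt0P; exists ord0; rewrite inE S0. Qed.

Lemma upto_le x : (upto x <= #|T|)%N.
Proof. by rewrite TS; apply/subset_leq_card/subsetP => y; rewrite inE => /andP[]. Qed.

Lemma upto_mono (x y : 'I_n.+1) : (x <= y)%N -> (upto x <= upto y)%N.
Proof.
move=> xy; apply/subset_leq_card/subsetP => z; rewrite !inE => /andP[->].
by move=> zx; rewrite (leq_trans zx xy).
Qed.

Lemma upto_ltn (x y : 'I_n.+1) : (x < y)%N -> y \in S -> (upto x < upto y)%N.
Proof.
move=> xy yS; rewrite /upto [X in (_ < X)%N](cardsD1 y) inE yS leqnn ltnS.
apply/subset_leq_card/subsetP => z; rewrite !inE => /andP[-> zx].
by rewrite (leq_trans zx (ltnW xy)) -val_eqE /= ltn_eqF // (leq_ltn_trans zx xy).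
Qed.

Definition preserving_fun : {ffun 'I_n.+1 -> 'I_n.+1} :=
  [ffun x => nth ord0 (enum T) (upto x).-1].

Lemma preserving_fun_lt (x y : 'I_n.+1) :
  (upto x < upto y)%N -> (preserving_fun x < preserving_fun y)%N.
Proof.
move=> lt; rewrite !ffunE; apply: enum_set_lt.
by have := upto_gt0 x; have := upto_le y; lia.
Qed.

Lemma preserving_fun_order : order_preserving preserving_fun.
Proof.
apply/(monoP _ leq) => x y /upto_mono; rewrite leq_eqVlt => /orP[/eqP e|].
  by rewrite !ffunE e.
by move/preserving_fun_lt/ltnW.
Qed.

Lemma od_preserving_subproof :
  order_preserving preserving_fun || order_reversing preserving_fun.
Proof. by rewrite preserving_fun_order. Qed.

Definition od_preserving := MkOD od_preserving_subproof.

Lemma reversing_preserving : reversing od_preserving = false.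
Proof. by rewrite /reversing preserving_fun_order. Qed.

Lemma fibre_mins_preserving : fibre_mins od_preserving = S.
Proof.
apply/setP=> x; rewrite inE; apply/forallP/idP => [xR|xS y]; last first.
  apply/implyP=> /upto_ltn/(_ xS)/preserving_fun_lt; rewrite -val_eqE /=.
  by rewrite neq_ltn => ->.
apply: contraT => xS; have x0 : (0 < x)%N.
  by rewrite lt0n; apply: contra xS => /eqP x0; rewrite (_ : x = ord0) //; apply: val_inj.
(* Off S the map takes the same value at x and at its predecessor. *)
have y_lt : (x.-1 < n.+1)%N by have := ltn_ord x; lia.
have /implyP := xR (Ordinal y_lt); rewrite /= prednK // leqnn => /(_ isT)/negP[].
rewrite !ffunE (_ : upto _ = upto x) //; apply: eq_card => z; rewrite !inE.
case zS: (z \in S) => //=; apply/idP/idP => /= [|zx]; first by lia.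
have : z != x by apply: contraNneq xS => <-.
by rewrite -val_eqE /=; lia.
Qed.

Lemma preserving_inj : {in S &, injective od_preserving}.
Proof. by have := @fibre_mins_inj n od_preserving; rewrite fibre_mins_preserving. Qed.

Lemma image_preserving : od_preserving @: S = T.
Proof.
apply/eqP; rewrite eqEcard TS card_in_imset ?leqnn ?andbT; last first.
  exact: preserving_inj.
apply/subsetP=> _ /imsetP[x _ ->]; rewrite ffunE -mem_enum mem_nth //.
by rewrite -cardE prednK ?upto_le // upto_gt0.
Qed.

End Preserving.

Lemma od_flip_subproof :
  order_preserving [ffun x : 'I_n.+1 => rev_ord x]
  || order_reversing [ffun x : 'I_n.+1 => rev_ord x].
Proof.
apply/orP; right; apply/(monoP _ geq) => x y xy; rewrite !ffunE /geq /=.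
exact: leq_sub2l.
Qed.
Definition od_flip : OD n.+1 := MkOD od_flip_subproof.

(** A reversing map is obtained by flipping an order-preserving one. *)
Lemma exists_od s S T : ord0 \in S -> #|T| = #|S| -> (min_size s <= #|S|)%N ->
  exists f, [/\ reversing f = s, fibre_mins f = S & f @: S = T].
Proof.
move=> S0 TS; case: s => /= sz; last first.
  exists (od_preserving S0 TS); split; first exact: reversing_preserving.
    exact: fibre_mins_preserving.
  exact: image_preserving.
pose T' := (@rev_ord n.+1) @: T.
have T'S : #|T'| = #|S| by rewrite card_imset //; apply: rev_ord_inj.
pose f := od_preserving S0 T'S; have flipE x : od_flip x = rev_ord x by rewrite ffunE.
have ffE x : (od_flip * f)%g x = rev_ord (f x) by rewrite -flipE ffunE.
exists (od_flip * f)%g; split.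
- have /card_gt1P[x [y [xS yS nxy]]] := sz.
  have finj : {in S &, injective f} by apply: preserving_inj.
  rewrite (@reversingM _ _ _ x y) ?reversing_preserving //; last first.
    by rewrite !ffE (inj_eq rev_ord_inj); apply: contra nxy => /eqP/finj->.
  rewrite addbF; wlog xy : x y xS yS nxy / (x <= y)%N => [wl|].
    by have [/wl|/ltnW/wl] := leqP x y; apply; rewrite // eq_sym.
  rewrite (reversingE xy); last by rewrite !flipE (inj_eq rev_ord_inj).
  by rewrite !flipE /=; move: nxy; rewrite -val_eqE /=; have := ltn_ord y; lia.
- rewrite -[RHS](fibre_mins_preserving S0 T'S); apply/setP=> x; rewrite !inE.
  by apply: eq_forallb => y; rewrite !ffE (inj_eq rev_ord_inj).
- rewrite -[RHS](_ : @rev_ord n.+1 @: T' = T); last first.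
    rewrite -imset_comp -[RHS]imset_id; apply: eq_imset => x /=; exact: rev_ordK.
  rewrite -(image_preserving S0 T'S) -imset_comp; apply: eq_imset => x.
  by rewrite ffE.
Qed.

Definition matrix_entry (p : bool * {set 'I_n.+1} * {set 'I_n.+1}) :=
  [&& ord0 \in p.1.2, #|p.2| == #|p.1.2| & (min_size p.1.1 <= #|p.1.2|)%N].
Definition entries := {p : bool * {set 'I_n.+1} * {set 'I_n.+1} | matrix_entry p}.

(** With [entries_of_inj] this inequality is an equality of dimensions. *)
Lemma card_entries : (#|{: entries}| <= #|{: OD n.+1}|)%N.
Proof.
have ex (p : entries) : exists f : OD n.+1,
    [&& reversing f == (val p).1.1, fibre_mins f == (val p).1.2
      & f @: (val p).1.2 == (val p).2].
  case: p => -[[s S] T] /= /and3P[S0 /eqP TS sz].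
  by have [f [rf Rf If]] := exists_od S0 TS sz; exists f; rewrite rf Rf If !eqxx.
apply: (@leq_card _ _ (fun p => xchoose (ex p))) => p q e.
have /and3P[/eqP p1 /eqP p2 /eqP p3] := xchooseP (ex p).
have /and3P[/eqP q1 /eqP q2 /eqP q3] := xchooseP (ex q).
apply: val_inj; rewrite e in p1 p2 p3.
move: p1 p2 p3; rewrite q1 q2 => e1 e2; rewrite -e2 q3 => e3.
by case: (val p) (val q) e1 e2 e3 => -[s S] T [[s' S'] T'] /= -> -> ->.
Qed.

End Existence.

Section Entries.
Variables (k : fieldType) (n : nat).
Local Notation A := (OD_algebra k n.+1).
Implicit Types (a b : A).
Hypothesis char_k : 2%N \notin [pchar k].

Definition entries_of a : {ffun entries n -> k^o} :=
  [ffun p : entries n => alg_act a (simplex k (val p).1) ((val p).1.1, (val p).2)].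

Lemma entries_of_linear : linear entries_of.
Proof. by move=> c a b; apply/ffunP=> p; rewrite !ffunE alg_actDl !ffunE. Qed.
HB.instance Definition _ :=
  GRing.isLinear.Build k A {ffun entries n -> k^o} _ entries_of entries_of_linear.

Lemma entries_of_inj : injective entries_of.
Proof.
apply: raddf_inj => a a0; apply: (od_faithful char_k) => -[s S] /= S0 sz.
rewrite (homog_sumE (homog_alg_act a (s := s) (S := S)) sz) big1 // => T TS.
have Pp : matrix_entry (s, S, T) by rewrite /matrix_entry /= S0 TS.
have /ffunP/(_ (Sub _ Pp : entries n)) := a0; rewrite !ffunE /= => ->.
by rewrite scale0r.
Qed.

Lemma entries_of_surj (c : {ffun entries n -> k^o}) : exists a, entries_of a = c.
Proof.
pose L : 'Hom(A, {ffun entries n -> k^o}) := linfun entries_of.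
have L_inj : lker L == 0%VS.
  by apply/lker0P => a b; rewrite !lfunE => /entries_of_inj.
suff full : limg L = fullv.
  have /memv_imgP[a _ ->] : c \in limg L by rewrite full memvf.
  by exists a; rewrite lfunE.
apply/eqP; rewrite eqEdim subvf limg_dim_eq; last by rewrite (eqP L_inj) capv0.
by rewrite !dimvf; apply: leq_mul; [exact: card_entries|].
Qed.

End Entries.

(** * Radical square zero algebras as corners *)

(** The faces that contain the least vertex generate the complexes: together
    with their boundaries they span all chains. *)
Definition cone_cell n (p : cell n.+1) := (ord0 \in p.2) && (min_size p.1 <= #|p.2|)%N.

(** The vertices of [Q] label one cone for each copy and size, and its arrows
    are the steps from one size to the next in the same copy. *)
Record cell_labelling (n : nat) (Q : quiver) := CellLabelling {
  lab_cell : vertex Q -> cell n.+1;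
  lab_cone : forall v, cone_cell (lab_cell v);
  lab_inj : forall v w, (lab_cell v).1 = (lab_cell w).1 ->
    #|(lab_cell v).2| = #|(lab_cell w).2| -> v = w;
  lab_surj : forall p : cell n.+1, cone_cell p ->
    exists v, ((lab_cell v).1 == p.1) && (#|(lab_cell v).2| == #|p.2|);
  lab_target : forall x : arrow Q,
    (lab_cell (target x)).1 = (lab_cell (source x)).1 /\
    #|(lab_cell (target x)).2| = #|(lab_cell (source x)).2|.+1;
  lab_arrow : forall v w, (lab_cell w).1 = (lab_cell v).1 ->
    #|(lab_cell w).2| = #|(lab_cell v).2|.+1 ->
    exists x : arrow Q, source x = v /\ target x = w;
  lab_source_inj : injective (source : arrow Q -> vertex Q) }.

Section Embedding.
Variables (k : fieldType) (n : nat).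
Local Notation A := (OD_algebra k n.+1).
Implicit Types (a b : A) (S T : {set 'I_n.+1}) (p q : cell n.+1).
Implicit Types (u : chains k n.+1).
Hypothesis char_k : 2%N \notin [pchar k].

Lemma alg_act_inj a b :
  (forall p, cone_cell p -> alg_act a (simplex k p) = alg_act b (simplex k p)) -> a = b.
Proof.
move=> ab; apply/eqP; rewrite -subr_eq0; apply/eqP.
apply: (od_faithful char_k) => p p0 sz.
rewrite -[a - b]addrC -scaleN1r alg_actDl ab; last by rewrite /cone_cell p0.
by rewrite scaleN1r addNr.
Qed.

(** In the right degree a chain is the family of its coordinates on simplices,
    so this is surjectivity of [entries_of]. *)
Lemma interpolation (c : cell n.+1 -> chains k n.+1) :
  (forall p, cone_cell p -> homog p.1 #|p.2| (c p)) ->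
  exists a, forall p, cone_cell p -> alg_act a (simplex k p) = c p.
Proof.
move=> hc; have [a ea] := entries_of_surj char_k
  [ffun p : entries n => c (val p).1 ((val p).1.1, (val p).2)].
exists a => -[s S] gS; have /andP[S0 sz] := gS.
rewrite (homog_sumE (homog_alg_act a (s := s) (S := S)) sz).
rewrite [RHS](homog_sumE (hc _ gS) sz); apply: eq_bigr => T TS; congr (_ *: _).
have Pp : matrix_entry (s, S, T) by rewrite /matrix_entry /= S0 TS.
by have /ffunP/(_ (Sub _ Pp : entries n)) := ea; rewrite !ffunE.
Qed.

Lemma exists_sending p u : exists a, cone_cell p -> homog p.1 #|p.2| u ->
  forall q, cone_cell q -> alg_act a (simplex k q) = if q == p then u else 0.
Proof.
have [hu|nhu] := pselect (homog p.1 #|p.2| u); last by exists 0.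
have [|a ea] := @interpolation (fun q => if q == p then u else 0).
  by move=> q _; case: eqP => [->//|_]; apply: homog0.
by exists a.
Qed.

Definition sending p u : A := projT1 (cid (exists_sending p u)).

Lemma sendingE p u q : cone_cell p -> homog p.1 #|p.2| u -> cone_cell q ->
  alg_act (sending p u) (simplex k q) = if q == p then u else 0.
Proof. by move=> gp hu; apply: (projT2 (cid (exists_sending p u))). Qed.

Lemma below0 S : below S ord0 = set0.
Proof. by apply/setP=> y; rewrite !inE ltn0 andbF. Qed.

(** The boundary of the cone over T is T plus faces that contain 0. *)
Lemma simplex_cone s T : ord0 \notin T -> simplex k (s, T) =
  bdry (simplex k (s, ord0 |: T)) -
  \sum_(x in T) (-1) ^+ #|below (ord0 |: T) x| *: simplex k (s, (ord0 |: T) :\ x).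
Proof.
move=> T0; rewrite bdry_simplex /bdry_cell /= big_setU1 //= setU1K //.
by rewrite below0 cards0 scale1r addrK.
Qed.

Lemma simplex_coef_neq p q : q != p -> simplex k p q = 0.
Proof. by move=> /negPf nqp; rewrite /simplex; case: ifP; rewrite ffunE ?nqp. Qed.

Lemma bdry_simplex_coef s S : ord0 \in S -> (min_size s <= #|S :\ ord0|)%N ->
  bdry (simplex k (s, S)) (s, S :\ ord0) = 1.
Proof.
move=> S0 sz; rewrite bdry_simplex /bdry_cell (bigD1 ord0) //= ffunE sum_ffunE.
rewrite big1 ?addr0 => [|x /andP[xS x0]].
  by rewrite below0 cards0 ffunE /simplex /= sz ffunE eqxx; apply: mulr1.
rewrite ffunE simplex_coef_neq ?scaler0 // xpair_eqE eqxx /=.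
by apply/eqP=> /setP/(_ ord0); rewrite !inE eqxx eq_sym x0 S0.
Qed.

Variables (Q : quiver) (L : cell_labelling n Q) (v0 : vertex Q).
Local Notation B := (rad_sq_zero k v0).
Local Notation vcell := (lab_cell L).
Local Notation vsize v := #|(vcell v).2|.

Lemma vcell_inj : injective vcell.
Proof. by move=> v w vw; apply: (lab_inj (c := L)); rewrite vw. Qed.

Local Notation vsimplex v := (simplex k (vcell v)).

Definition vertex_elt (v : vertex Q) : A := sending (vcell v) (vsimplex v).
Definition arrow_elt (x : arrow Q) : A :=
  sending (vcell (source x)) (bdry (vsimplex (target x))).

Lemma vertex_eltE v q : cone_cell q ->
  alg_act (vertex_elt v) (simplex k q) = if q == vcell v then vsimplex v else 0.
Proof.
apply: sendingE; first exact: lab_cone.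
by rewrite {2}[vcell v]surjective_pairing; apply: homog_simplex.
Qed.

Lemma arrow_eltE x q : cone_cell q -> alg_act (arrow_elt x) (simplex k q) =
  if q == vcell (source x) then bdry (vsimplex (target x)) else 0.
Proof.
apply: sendingE; first exact: lab_cone.
have [ts tl] := lab_target L x.
have := @homog_bdry_simplex k n.+1 (vcell (target x)).1 (vcell (target x)).2.
by rewrite -surjective_pairing tl ts.
Qed.

Definition embed (f : B) : A :=
  \sum_v f (inl v) *: vertex_elt v + \sum_x f (inr x) *: arrow_elt x.

Lemma embed_linear : linear embed.
Proof.
move=> c f g; rewrite /embed scalerDr addrACA !scaler_sumr -!big_split /=.
by congr (_ + _); apply: eq_bigr => z _; rewrite rsz_coefP.
Qed.
HB.instance Definition _ := GRing.isLinear.Build k B A _ embed embed_linear.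

Lemma embed_act_sum f q : cone_cell q -> alg_act (embed f) (simplex k q) =
  \sum_v f (inl v) *: (if q == vcell v then vsimplex v else 0) +
  \sum_x f (inr x) *: (if q == vcell (source x) then bdry (vsimplex (target x)) else 0).
Proof.
move=> gq; rewrite /embed -[X in alg_act (X + _)]scale1r alg_actDl scale1r.
rewrite !alg_act_suml; congr (_ + _); apply: eq_bigr => z _.
  by rewrite vertex_eltE.
by rewrite arrow_eltE.
Qed.

Lemma embed_act f v : alg_act (embed f) (vsimplex v) =
  f (inl v) *: vsimplex v +
  \sum_(x | source x == v) f (inr x) *: bdry (vsimplex (target x)).
Proof.
rewrite embed_act_sum ?lab_cone //; congr (_ + _).
  rewrite (bigD1 v) //= eqxx big1 ?addr0 // => w nwv.
  by rewrite (inj_eq vcell_inj) eq_sym (negPf nwv) scaler0.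
rewrite [RHS]big_mkcond; apply: eq_bigr => x _.
by rewrite (inj_eq vcell_inj) eq_sym; case: ifP => // _; rewrite scaler0.
Qed.

Lemma embed_act0 f q : cone_cell q -> (forall v, q != vcell v) ->
  alg_act (embed f) (simplex k q) = 0.
Proof.
move=> gq nq; rewrite embed_act_sum // !big1 ?addr0 // => z _.
  by rewrite (negPf (nq _)) scaler0.
by rewrite (negPf (nq _)) scaler0.
Qed.

Lemma embed_actP a b : (forall v, alg_act a (vsimplex v) = alg_act b (vsimplex v)) ->
  (forall q, cone_cell q -> (forall v, q != vcell v) ->
     alg_act a (simplex k q) = 0 /\ alg_act b (simplex k q) = 0) -> a = b.
Proof.
move=> abv ab0; apply: alg_act_inj => q gq.
have [/existsP[v /eqP->]|/existsPn nq] := boolP [exists v, q == vcell v].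
  exact: abv.
by have [-> ->] := ab0 q gq nq.
Qed.

(** Both sides are compared on the labelled cones S. Since [embed f] commutes
    with d, it maps dS to a multiple of dS: the arrows contribute to this only
    terms d d = 0. *)
Lemma embedM f g : embed (f * g) = embed f * embed g.
Proof.
apply: embed_actP => [v|q gq nq]; last first.
  by rewrite alg_actM !embed_act0 // linear0.
rewrite alg_actM !embed_act linearD linearZ /= embed_act.
rewrite (linear_sum (alg_act (embed f))) /=.
under [X in _ = _ + X]eq_bigr => x _.
  rewrite linearZ /= alg_act_bdry embed_act linearD linearZ /=.
  rewrite (linear_sum (@bdry k n.+1)) big1 /=; last first.
    by move=> y _; rewrite linearZ /= bdry_bdry scaler0.
  rewrite addr0 scalerA; over.
rewrite scalerDr scalerA scaler_sumr -addrA -big_split /=.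
congr (_ + _); first by rewrite (rszME f g) mulrC.
apply: eq_bigr => x /eqP sx; rewrite (rszME f g) scalerA -scalerDl sx.
by congr (_ *: _); rewrite addrC ![_ * g _]mulrC.
Qed.

(** Let x be the arrow with source v, and S the cone of its target. The face of
    S opposite to 0 occurs in dS with coefficient 1 and is not a cone, so it
    singles out the coefficient of x in the value at v. *)
Lemma embed_inj : injective embed.
Proof.
apply: raddf_inj => f f0.
have e v : f (inl v) *: vsimplex v +
    \sum_(x | source x == v) f (inr x) *: bdry (vsimplex (target x)) = 0.
  by rewrite -embed_act f0 alg_act0l.
have fx x : f (inr x) = 0.
  have := e (source x); rewrite (big_pred1 x) => [|y]; last first.
    by rewrite (inj_eq (lab_source_inj L)).
  move=> /ffunP/(_ ((vcell (target x)).1, (vcell (target x)).2 :\ ord0)).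
  have /andP[x0 _] := lab_cone L (target x).
  have [tx1 tx2] := lab_target L x.
  rewrite !ffunE simplex_coef_neq; last first.
    rewrite [vcell (source x)]surjective_pairing xpair_eqE; apply/nandP; right.
    apply/eqP=> /setP/(_ ord0); have /andP[-> _] := lab_cone L (source x).
    by rewrite !inE eqxx.
  rewrite [X in simplex k X]surjective_pairing bdry_simplex_coef //; last first.
    have /andP[_] := lab_cone L (source x); rewrite tx1.
    by move: tx2; rewrite (cardsD1 ord0) x0 => /addnI<-.
  by rewrite scaler0 add0r => /eqP; rewrite mulf_eq0 oner_eq0 orbF => /eqP.
have fv v : f (inl v) = 0.
  have := e v; rewrite big1 ?addr0 => [|x _]; last by rewrite fx scale0r.
  move=> /ffunP/(_ (vcell v)); rewrite !ffunE /simplex.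
  by have /andP[_ ->] := lab_cone L v; rewrite ffunE eqxx => /eqP;
    rewrite mulf_eq0 oner_eq0 orbF => /eqP.
by apply/ffunP=> -[v|x]; rewrite ffunE.
Qed.

(** The possible values of elements of the image of [embed] on the cone of v. *)
Definition in_image v u := exists f : B,
  u = f (inl v) *: vsimplex v +
  \sum_(x | source x == v) f (inr x) *: bdry (vsimplex (target x)).

Lemma in_imageP v c u u' : in_image v u -> in_image v u' -> in_image v (c *: u + u').
Proof.
move=> [f ->] [g ->]; exists (c *: f + g).
rewrite scalerDr addrACA scaler_sumr -big_split /= rsz_coefP; congr (_ + _).
by apply: eq_bigr => x _; rewrite rsz_coefP.
Qed.

Lemma in_image0 v : in_image v 0.
Proof.
exists 0; rewrite ffunE scale0r add0r big1 // => x _; by rewrite ffunE scale0r.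
Qed.

Lemma in_image_sum v (J : finType) (P : pred J) (c : J -> k) F :
  (forall j, P j -> in_image v (F j)) -> in_image v (\sum_(j | P j) c j *: F j).
Proof.
move=> hF; apply: (big_rec (in_image v)) => [|j w Pj hw]; first exact: in_image0.
by apply: in_imageP => //; apply: hF.
Qed.

Lemma embed1 v : alg_act (embed 1) (vsimplex v) = vsimplex v.
Proof.
rewrite embed_act rsz1E scale1r big1 ?addr0 // => x _.
by rewrite rsz1E scale0r.
Qed.

Lemma in_image_vsimplex v : in_image v (vsimplex v).
Proof. by exists 1; rewrite -embed_act embed1. Qed.

Lemma in_image_bdry v x : source x = v -> in_image v (bdry (vsimplex (target x))).
Proof.
move=> sx; exists (rsz_basis k v0 (inr x)).
rewrite ffunE scale0r add0r (bigD1 x) ?sx //= ffunE eqxx scale1r.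
rewrite big1 ?addr0 // => y /andP[_ /negPf nyx].
by rewrite ffunE (inj_eq inr_inj) nyx scale0r.
Qed.

Lemma cone_cell_vertex v S : ord0 \in S -> #|S| = vsize v -> cone_cell ((vcell v).1, S).
Proof.
by have := lab_cone L v; rewrite /cone_cell /= => /andP[_ +] -> ->.
Qed.

Lemma embed1_simplex v S : ord0 \in S -> #|S| = vsize v ->
  in_image v (alg_act (embed 1) (simplex k ((vcell v).1, S))).
Proof.
move=> S0 Sv; have gS := cone_cell_vertex S0 Sv.
have [/existsP[w /eqP ew]|/existsPn nq] :=
  boolP [exists w, ((vcell v).1, S) == vcell w].
  have wv : w = v by apply: (lab_inj (c := L)); rewrite -?ew // -Sv -ew.
  by rewrite ew wv embed1; apply: in_image_vsimplex.
by rewrite embed_act0 //; apply: in_image0.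
Qed.

Lemma embed1_bdry v S : ord0 \in S -> #|S| = (vsize v).+1 ->
  in_image v (alg_act (embed 1) (bdry (simplex k ((vcell v).1, S)))).
Proof.
move=> S0 Sv; rewrite alg_act_bdry.
have gS : cone_cell ((vcell v).1, S).
  have := lab_cone L v; rewrite /cone_cell /= S0 Sv => /andP[_ sz].
  exact: leq_trans sz (leqnSn _).
have [/existsP[w /eqP ew]|/existsPn nq] :=
  boolP [exists w, ((vcell v).1, S) == vcell w].
  have [||x [sx tx]] := @lab_arrow _ _ L v w; first by rewrite -ew.
    by rewrite -ew /= Sv.
  by rewrite ew embed1 -tx; apply: in_image_bdry.
by rewrite embed_act0 // linear0; apply: in_image0.
Qed.

(** The idempotent [embed 1] kills the cones other than the labelled ones, and
    commutes with d. In the degree of v it therefore leaves only the cone of v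
    and the boundary of the cone of the next size, which belongs to an arrow
    with source v. *)
Lemma embed1_homog v u : homog (vcell v).1 (vsize v) u ->
  in_image v (alg_act (embed 1) u).
Proof.
move=> hu; have /andP[_] := lab_cone L v => sz.
rewrite (homog_sumE hu sz) (linear_comb (alg_act (embed 1))).
apply: in_image_sum => T /eqP Tv /=.
have [T0|T0] := boolP (ord0 \in T); first exact: embed1_simplex.
rewrite simplex_cone // linearB /= addrC -scaleN1r; apply: in_imageP; last first.
  by apply: embed1_bdry; rewrite ?setU11 // cardsU1 T0 Tv.
rewrite (linear_comb (alg_act (embed 1))); apply: in_image_sum => x xT /=.
apply: embed1_simplex; first by rewrite !inE eqxx andbT; apply: contraNneq T0 => ->.
apply: (@addnI 1%N); rewrite -Tv; have := cardsU1 ord0 T; rewrite T0 => <-.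
by rewrite (cardsD1 x (ord0 |: T)) !inE xT orbT.
Qed.

(** An element of the corner is determined by its values on the labelled cones,
    and these have the right form by [embed1_homog]. *)
Lemma embed_corner a : exists f, embed f = embed 1 * a * embed 1.
Proof.
have im v : in_image v (alg_act (embed 1 * a * embed 1) (vsimplex v)).
  rewrite !alg_actM embed1; apply: embed1_homog.
  by rewrite {2}[vcell v]surjective_pairing; apply: homog_alg_act.
have [F hF] : exists F : vertex Q -> B, forall v,
    alg_act (embed 1 * a * embed 1) (vsimplex v) = F v (inl v) *: vsimplex v +
    \sum_(x | source x == v) F v (inr x) *: bdry (vsimplex (target x)).
  by exists (fun v => projT1 (cid (im v))) => v; apply: (projT2 (cid (im v))).
exists [ffun z => match z with
  | inl v => F v (inl v) | inr x => F (source x) (inr x) end].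
apply: embed_actP => [v|q gq nq]; last first.
  by rewrite !alg_actM !embed_act0 // !linear0.
apply: esym; apply: etrans (hF v) _; rewrite embed_act ffunE; congr (_ + _).
by apply: eq_bigr => x /eqP sx; rewrite ffunE sx.
Qed.

(** ** Fullness *)

Definition vertex_of p : vertex Q :=
  odflt v0 [pick v | ((vcell v).1 == p.1) && (vsize v == #|p.2|)].

Lemma vertex_ofP p : cone_cell p ->
  (vcell (vertex_of p)).1 = p.1 /\ vsize (vertex_of p) = #|p.2|.
Proof.
move=> /(lab_surj L)[v hv]; rewrite /vertex_of.
case: pickP => [w /andP[/eqP-> /eqP->]//|].
by move=> /(_ v); rewrite hv.
Qed.

Definition from_vertex p : A :=
  if cone_cell p then sending (vcell (vertex_of p)) (simplex k p) else 0.
Definition to_vertex p : A := sending p (vsimplex (vertex_of p)).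

Lemma from_vertexE p : cone_cell p ->
  alg_act (from_vertex p) (vsimplex (vertex_of p)) = simplex k p.
Proof.
move=> gp; rewrite /from_vertex gp sendingE ?lab_cone ?eqxx //.
have [-> sz] := vertex_ofP gp; rewrite sz.
by rewrite {2}[p]surjective_pairing; apply: homog_simplex.
Qed.

Lemma to_vertexE p q : cone_cell p -> cone_cell q ->
  alg_act (to_vertex p) (simplex k q) = if q == p then vsimplex (vertex_of p) else 0.
Proof.
move=> gp gq; rewrite sendingE //; have [<- <-] := vertex_ofP gp.
by rewrite {2}[vcell _]surjective_pairing; apply: homog_simplex.
Qed.

(** Each cone can be moved to the labelled cone of its size and back. *)
Lemma embed_full : \sum_p from_vertex p * embed 1 * to_vertex p = 1.
Proof.
apply: alg_act_inj => q gq; rewrite alg_act1.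
under eq_bigr => p _ do rewrite -[_ * to_vertex p]scale1r.
rewrite alg_act_suml (bigD1 q) //= !alg_actM to_vertexE // eqxx embed1.
rewrite from_vertexE // scale1r big1 ?addr0 // => p npq; rewrite !alg_actM.
have [gp|ngp] := boolP (cone_cell p); last first.
  by rewrite /from_vertex (negPf ngp) alg_act0l scaler0.
by rewrite to_vertexE // eq_sym (negPf npq) !linear0 ?scaler0.
Qed.

Definition OD_full_corner : full_corner A B :=
  @FullCorner k A B embed embedM embed_inj
    (fun a => projT1 (cid (embed_corner a)))
    (fun a => projT2 (cid (embed_corner a)))
    (cell n.+1) from_vertex to_vertex embed_full.

Lemma OD_morita : morita_equivalent A B.
Proof. exact: full_corner_morita OD_full_corner. Qed.

End Embedding.

(** * The two straight lines *)

Section Labelling.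
Variable n : nat.

Definition segment (m : nat) : {set 'I_n.+1} := [set x : 'I_n.+1 | (x <= m)%N].

Lemma card_segment m : (m <= n)%N -> #|segment m| = m.+1.
Proof.
move=> mn; have lt : (m.+1 <= n.+1)%N by [].
have winj : injective (widen_ord lt) by move=> x y /(congr1 val) /= /val_inj.
rewrite -[RHS]card_ord -(card_imset _ winj).
apply: eq_card => x; rewrite inE; apply/idP/imsetP => [xm|[y _ ->]].
  by exists (Ordinal (xm : (x < m.+1)%N)) => //; apply: val_inj.
exact: ltn_ord y.
Qed.

Local Notation Q := (quiver_sum (straightline_path n) (straightline_path n.+1)).

Definition segment_cell (v : vertex Q) : cell n.+1 :=
  match v with
  | inl i => (true, segment i.+1)
  | inr i => (false, segment i)
  end.

Definition segment_size (v : vertex Q) : nat :=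
  match v with inl i => i.+2 | inr i => i.+1 end.

Lemma card_segment_cell v : #|(segment_cell v).2| = segment_size v.
Proof. by case: v => i /=; rewrite card_segment // ?ltn_ord // -ltnS ltn_ord. Qed.

Lemma segment_cell_cone v : cone_cell (segment_cell v).
Proof. by rewrite /cone_cell card_segment_cell; case: v => i; rewrite /= inE. Qed.

Lemma segment_cell_inj v w : (segment_cell v).1 = (segment_cell w).1 ->
  #|(segment_cell v).2| = #|(segment_cell w).2| -> v = w.
Proof.
by rewrite !card_segment_cell; case: v w => i [] j //= _ [/val_inj->].
Qed.

Lemma segment_cell_surj (p : cell n.+1) : cone_cell p -> exists v,
  ((segment_cell v).1 == p.1) && (#|(segment_cell v).2| == #|p.2|).
Proof.
case: p => s S /andP[_ /=]; have := max_card S; rewrite card_ord.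
move: #|S| => m; case: s => /= mn sz.
  have lt : (m - 2 < n)%N by lia.
  by exists (inl (Ordinal lt)); rewrite card_segment_cell; apply/eqP => /=; lia.
have lt : (m - 1 < n.+1)%N by lia.
by exists (inr (Ordinal lt)); rewrite card_segment_cell; apply/eqP => /=; lia.
Qed.

Lemma segment_cell_target (x : arrow Q) :
  (segment_cell (target x)).1 = (segment_cell (source x)).1 /\
  #|(segment_cell (target x)).2| = #|(segment_cell (source x)).2|.+1.
Proof. by rewrite !card_segment_cell; case: x => -[[i j] /= /eqP ->]. Qed.

Lemma segment_cell_arrow v w : (segment_cell w).1 = (segment_cell v).1 ->
  #|(segment_cell w).2| = #|(segment_cell v).2|.+1 ->
  exists x : arrow Q, source x = v /\ target x = w.
Proof.
rewrite !card_segment_cell; case: v w => i [] j //= _ [e].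
  have ij : (i, j).2 == (i, j).1.+1 :> nat by rewrite /= e.
  by exists (inl (Sub (i, j) ij)).
have ij : (i, j).2 == (i, j).1.+1 :> nat by rewrite /= e.
by exists (inr (Sub (i, j) ij)).
Qed.

Lemma straightline_source_inj m :
  injective (source : arrow (straightline_path m) -> _).
Proof.
case=> -[i j] ij [[i' j'] ij'] /= ii; apply: val_inj; rewrite /= ii.
congr pair; apply: val_inj; move: (eqP ij) (eqP ij') => /= -> ->.
by rewrite ii.
Qed.

Lemma quiver_source_inj : injective (source : arrow Q -> vertex Q).
Proof. by case=> x [] y //= -[] /straightline_source_inj->. Qed.

Definition segment_labelling : cell_labelling n Q :=
  CellLabelling segment_cell_cone segment_cell_inj segment_cell_surj
    segment_cell_target segment_cell_arrow quiver_source_inj.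

End Labelling.

Theorem corollary3p23 (n : nat) (k : fieldType) (n_gt0 : (1 <= n)%N)
    (char_k : 2%N \notin [pchar k]) :
  let Q := quiver_sum (straightline_path n.-1) (straightline_path n) in
  is_quiver_of (OD_algebra k n) Q /\
  is_presentation_of (OD_algebra k n)
    (@consecutive_arrows_zero k Q).
Proof.
case: n n_gt0 => [//|n] _ Q.
pose v0 : vertex Q := inr ord0.
have morita : morita_equivalent (OD_algebra k n.+1) (rad_sq_zero k v0).
  exact: (OD_morita char_k (segment_labelling n)).
split; exists (rad_sq_zero k v0).
  split; [exact: split_basic_rsz|exact: morita|].
  by exists (fun v => rsz_basis k v0 (inl v)); 
    [exact: rsz_complete|exact: rsz_is_quiver].
by split; [exact: split_basic_rsz|exact: morita|exact: rsz_is_presentation].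
Qed.
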